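(* For every fixed $k\ge3$ and every $0<\eta<1/2$ there is a constant $C_{\eta,k}$ such that, for all sufficiently large $n$, $$W^{\mathrm{NAE}}_{\eta,k}(n)\le C_{\eta,k}\,\frac{n}{\log n}.$$
   Context: Random signed NAE-$k$-SAT. Variables are Boolean. A signed NAE clause is specified by a $k$-set $S\subseteq[n]$ and an antipodal class $[a]=\{a,\bar a\}\subseteq\{0,1\}^S$ ($\bar a$ the coordinatewise complement); it is violated exactly by the assignments $x\in\{0,1\}^n$ with $x_S\in\{a,\bar a\}$. Let $\mathcal N_{n,k}$ be the set of all signed NAE clauses, $N^{\mathrm{NAE}}_{n,k}=|\mathcal N_{n,k}|=2^{k-1}\binom nk$. Each clause is included independently with probability $p$ (product measure $\mu_p$), and $\mathrm{Cover}^{\mathrm{NAE}}_{n,k}$ is the event that the violated sets of the selected clauses cover $\{0,1\}^n$, i.e. the formula is NAE-unsatisfiable. For $0<\alpha<1$, $p_\alpha=p_\alpha(n)=\inf\{p\in[0,1]:\mu_p(\mathrm{Cover}^{\mathrm{NAE}}_{n,k})\ge\alpha\}$ (so $\mu_{p_\alpha}(\mathrm{Cover}^{\mathrm{NAE}}_{n,k})=\alpha$), and $W^{\mathrm{NAE}}_{\eta,k}(n)=N^{\mathrm{NAE}}_{n,k}(p_{1-\eta}-p_\eta)$. *)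

(* Defs.v *)
From HB Require Import structures.
From mathcomp Require Import all_boot all_order all_algebra.
From mathcomp Require Import all_classical all_reals all_analysis.

Set Implicit Arguments.
Unset Strict Implicit.
Unset Printing Implicit Defensive.

Import Order.TTheory GRing.Theory Num.Theory.
Local Open Scope ring_scope.

Notation assignment n := {ffun 'I_n -> bool}.

(* {0,1}^S *)
Notation local_assignment S := {ffun {i | i \in S} -> bool}.

Section Clauses.
Variables n k : nat.
Implicit Type S : {set 'I_n}.

Definition restrict_to S (x : assignment n) : local_assignment S :=
  [ffun i => x (val i)].

Definition antipode S (a : local_assignment S) : local_assignment S :=
  [ffun i => ~~ a i].

Definition antipodal_class S (a : local_assignment S) :
  {set local_assignment S} := [set a; antipode a]%SET.

(* A clause is a dependent pair (S, [a]), the class [a] being a two-element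
   set of points of {0,1}^S (for S nonempty), so that a and its complement give
   the same clause. *)
Definition is_nae_clause
    (c : {S : {set 'I_n} & {set local_assignment S}}) : bool :=
  (#|tag c| == k) && [exists a, tagged c == antipodal_class a].

Record nae_clause := NaeClause {
  nae_val :> {S : {set 'I_n} & {set local_assignment S}};
  _ : is_nae_clause nae_val }.

HB.instance Definition _ := [isSub for nae_val].
HB.instance Definition _ := [Finite of nae_clause by <:].

Definition violated (c : nae_clause) : {set assignment n} :=
  [set x | restrict_to (tag (nae_val c)) x \in tagged (nae_val c)]%SET.

(* A formula is the set F of its selected clauses. *)
Definition nae_cover : {set {set nae_clause}} :=
  [set F : {set nae_clause} |
    (\bigcup_(c in F) violated c)%SET == [set: assignment n]%SET]%SET.

Lemma antipodeK S : involutive (@antipode S).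
Proof. by move=> a; apply/ffunP => i; rewrite !ffunE negbK. Qed.

Lemma card_antipodal_classes S : (0 < #|S|)%N ->
  #|[set P | [exists a, P == @antipodal_class S a]]%SET| = (2 ^ #|S|.-1)%N.
Proof.
move=> S0; have [i iS] := card_gt0P S0.
have neq (a : local_assignment S) : a != antipode a.
  apply/eqP => /ffunP /(_ (exist _ i iS)).
  by rewrite ffunE; case: (a _).
have -> : [set P | [exists a, P == @antipodal_class S a]]%SET =
          (@antipodal_class S @: [set: local_assignment S])%SET.
  apply/setP => P; rewrite inE; apply/existsP/imsetP.
    by case=> a /eqP ->; exists a.
  by case=> a _ ->; exists a.
apply/eqP; rewrite -(eqn_pmul2r (isT : (0 < 2)%N)) -expnSr prednK//.
have <- : #|[set: local_assignment S]| = (2 ^ #|S|)%N.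
  by rewrite cardsT card_ffun card_bool card_sig.
rewrite -[X in _ == X]sum1_card (partition_big_imset (@antipodal_class S)) /=.
rewrite -sum_nat_const; apply/eqP/eq_bigr => P /imsetP[a _ ->].
have -> : 2%N = #|antipodal_class a| by rewrite /antipodal_class cards2 neq.
rewrite sum1_card; apply: eq_card => b; rewrite !inE /=.
rewrite [RHS]unfold_in /= !inE /=; apply/idP/eqP => [|e].
  case/orP => /eqP -> //; rewrite /antipodal_class antipodeK.
  by rewrite finset.setUC.
have : b \in antipodal_class b by rewrite !inE eqxx.
by rewrite e !inE.
Qed.

Lemma card_nae_clause : (0 < k)%N ->
  #|{: nae_clause}| = (2 ^ k.-1 * 'C(n, k))%N.
Proof.
move=> k0; rewrite card_sub -sum1_card.
rewrite (eq_bigl (fun c : {S : {set 'I_n} & {set local_assignment S}} =>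
  (#|tag c| == k) && [exists a, tagged c == antipodal_class a]))//.
rewrite -(@sig_big_dep _ _ _ _ (fun S : {set 'I_n} => {set local_assignment S})
  (fun S : {set 'I_n} => #|S| == k)
  (fun S P => [exists a, P == @antipodal_class S a]) (fun _ _ => 1%N)) /=.
rewrite (eq_bigr (fun=> 2 ^ k.-1)%N) => [|S /eqP Sk].
  rewrite sum_nat_const mulnC; congr (_ * _)%N.
  rewrite -[in RHS](card_ord n) -card_draws.
  by apply: eq_card => S; rewrite !inE.
rewrite -Sk -card_antipodal_classes ?Sk// -sum1_card.
by apply: eq_bigl => P; rewrite inE.
Qed.

End Clauses.

(* The law of a random subset of T containing each element independently with
   probability p. *)
Definition product_measure (R : realType) (T : finType) (p : R)
    (E : {set {set T}}) : R :=
  \sum_(F in E) \prod_(c : T) (if c \in F then p else 1 - p).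

Lemma product_measureT (R : realType) (T : finType) (p : R) :
  product_measure p [set: {set T}]%SET = 1.
Proof.
rewrite /product_measure; transitivity (\prod_(c : T) (p + (1 - p))).
  by rewrite bigA_distr; apply: eq_bigl => F; rewrite !inE.
by rewrite big1// => c _; rewrite addrC subrK.
Qed.

(* For n < k there are no clauses, the set below is empty when 0 < alpha, and
   its inf is the default value 0; this affects only finitely many n. *)
Definition p_nae (R : realType) (k n : nat) (alpha : R) : R :=
  inf [set p : R | 0 <= p <= 1 /\
                   alpha <= product_measure p (nae_cover n k)]%classic.

Definition window_nae (R : realType) (eta : R) (k n : nat) : R :=
  #|{: nae_clause n k}|%:R * (p_nae k n (1 - eta) - p_nae k n eta).

(* Main.v *)
(** The probability mu(p) of unsatisfiability has derivative sum_x E[d_x f], f being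
    the indicator of unsatisfiability.  If the window were wider than C n / log n
    clauses with C large, it would contain a p where the total influence p mu'(p)
    is at most eps log n, while mu grows by less than n^(-1/2) over the next
    n^(1/4) clauses.

    At such a p, suppose first that no satisfiable set {x} u U of O(eps log n)
    clauses makes x pivotal for F u U with probability above n^(-O(eps)).  Then
    each d_x f is global, up to small minimal unsatisfiable formulas; these are
    rare because each of their variables lies in two clauses, so that w clauses
    span at most k w / 2 variables.  Hypercontractivity for global functions in the
    p-biased cube then bounds the Fourier weight of f at levels 1, ..., d, with d a
    multiple of eps log n, and the weight above is at most the total influence
    over d.  So the variance of f is too small for mu(p) to lie in [eta, 1 - eta].

    Otherwise, fixing the O(eps log n) variables of {x} u U to values satisfying
    these clauses makes F unsatisfiable with probability n^(-O(eps)).  By symmetry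
    so do random literals, and these can be traded one by one for n^(O(eps)) random
    clauses in all; so mu would grow by n^(-O(eps)) over these few clauses. *)
Require Import Defs.
From mathcomp Require Import all_boot all_order all_algebra.
From mathcomp Require Import all_classical all_reals all_analysis.
From mathcomp Require Import all_fingroup fintype finset ring lra zify.
From mathcomp Require polyrcf.
Set Implicit Arguments.
Unset Strict Implicit.
Unset Printing Implicit Defensive.
Import Order.TTheory GRing.Theory Num.Theory.
Local Open Scope ring_scope.

(** * Expectation over a random subset *)

(** Here [p] is at most of order [n^(1-k)], where the hypercontractive constant of the biased cube
    degenerates. The fourth moment is therefore bounded through the second moments of all iterated
    derivatives, with constants free of [p]; globalness is exactly what controls these.

    The bound [k >= 3] makes minimal unsatisfiable formulas rare: up to polylogarithmic factors per
    clause there are at most [n^(k w / 2)] of them with [w] clauses, each present with probability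
    at most about [n^((1-k) w)], which leaves [n^((1 - k/2) w) <= n^(-w/2)].

    The dichotomy is decided by one number, the probability [kills] that [F] is satisfiable but has
    no solution agreeing with [M] given literals on distinct variables; permuting and flipping
    variables shows that it is the same for every choice.

    All scales depend on one integer [d], the integer part of [log n] in base [Q]: restrictions to
    fewer than [m = 20 d] clauses, [M = k m] literals, a threshold of order [2^-m]. Every size that
    [n] has to exceed is at most exponential in [d], so that one constant [Q] serves all of them. *)

Section Splitting.
Variables (V : zmodType) (T : finType).

Lemma sum_split_at (x : T) (phi : {set T} -> V) :
  \sum_(F : {set T}) phi F =
  \sum_(F : {set T} | x \notin F) (phi F + phi (x |: F)).
Proof.
rewrite (bigID (fun F : {set T} => x \notin F)) /= big_split /=; congr (_ + _).
rewrite (reindex_onto (fun F => x |: F) (fun F => F :\ x)) /=; last first.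
  by move=> F; rewrite negbK => xF; rewrite setD1K.
apply: eq_bigl => F; rewrite !inE eqxx /=.
apply/eqP/idP => [<-|xF]; first by rewrite !inE eqxx.
by rewrite setU1K.
Qed.

End Splitting.

Section Expectation.
Variables (R : realFieldType) (T : finType).
Implicit Types (p : R) (F S : {set T}) (h : {set T} -> R).

Definition set_weight p F : R := \prod_(c : T) (if c \in F then p else 1 - p).

Definition Ex p h : R := \sum_(F : {set T}) set_weight p F * h F.

Lemma eq_Ex p h1 h2 : h1 =1 h2 -> Ex p h1 = Ex p h2.
Proof. by move=> h12; apply: eq_bigr => F _; rewrite h12. Qed.

Lemma ExD p h1 h2 : Ex p (fun F => h1 F + h2 F) = Ex p h1 + Ex p h2.
Proof. by rewrite -big_split; apply: eq_bigr => F _ /=; rewrite mulrDr. Qed.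

Lemma ExZ p a h : Ex p (fun F => a * h F) = a * Ex p h.
Proof. by rewrite mulr_sumr; apply: eq_bigr => F _ /=; rewrite mulrCA. Qed.

Lemma ExB p h1 h2 : Ex p (fun F => h1 F - h2 F) = Ex p h1 - Ex p h2.
Proof.
rewrite -[- Ex p h2]mulN1r -ExZ -ExD; apply: eq_Ex => F; by rewrite mulN1r.
Qed.

Lemma Ex_sum p (I : Type) (r : seq I) (P : pred I) (h : I -> {set T} -> R) :
  Ex p (fun F => \sum_(i <- r | P i) h i F) = \sum_(i <- r | P i) Ex p (h i).
Proof.
rewrite /Ex exchange_big /=; apply: eq_bigr => F _; by rewrite mulr_sumr.
Qed.

Lemma set_weight_ge0 p F : 0 <= p <= 1 -> 0 <= set_weight p F.
Proof.
by move=> /andP[p0 p1]; apply: prodr_ge0 => c _; case: ifP => _ //; rewrite subr_ge0.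
Qed.

Lemma le_Ex p h1 h2 : 0 <= p <= 1 -> (forall F, h1 F <= h2 F) ->
  Ex p h1 <= Ex p h2.
Proof.
by move=> p01 h12; apply: ler_sum => F _; rewrite ler_wpM2l// set_weight_ge0.
Qed.

Lemma Ex_ge0 p h : 0 <= p <= 1 -> (forall F, 0 <= h F) -> 0 <= Ex p h.
Proof. by move=> p01 h0; apply: sumr_ge0 => F _; rewrite mulr_ge0// set_weight_ge0. Qed.

Let weight_off p x F : R := \prod_(c : T | c != x) (if c \in F then p else 1 - p).

Let weightU p x F : x \notin F -> set_weight p (x |: F) = p * weight_off p x F.
Proof.
move=> xF; rewrite /set_weight (bigD1 x) //= !inE eqxx /=; congr (_ * _).
by apply: eq_bigr => c cx; rewrite !inE (negbTE cx).
Qed.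

Let weightN p x F : x \notin F -> set_weight p F = (1 - p) * weight_off p x F.
Proof. by move=> xF; rewrite /set_weight (bigD1 x) //= (negbTE xF). Qed.

Lemma Ex_resample p x h :
  Ex p h = Ex p (fun F => p * h (x |: F) + (1 - p) * h (F :\ x)).
Proof.
rewrite /Ex !(sum_split_at x) /=; apply: eq_bigr => F xF.
have FDx : F :\ x = F by apply/setDidPl; rewrite disjoint_sym disjoints1.
by rewrite weightU// (weightN _ xF) setUA setUid setU1K// FDx; ring.
Qed.

Lemma Ex1 p : Ex p (fun=> 1) = 1.
Proof.
transitivity (\prod_(c : T) (p + (1 - p))); last first.
  by rewrite big1// => c _; rewrite addrC subrK.
by rewrite bigA_distr; apply: eq_bigr => F _; rewrite mulr1 /set_weight big_mkcond /=.
Qed.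

Lemma Ex_cst p a : Ex p (fun=> a) = a.
Proof. by rewrite -[RHS]mulr1 -(Ex1 p) -ExZ; apply: eq_Ex => F; rewrite mulr1. Qed.

End Expectation.

(** * Fourier expansion in the biased cube *)

Section Fourier.
Variables (R : realFieldType) (T : finType) (p : R).
Hypothesis p01 : 0 < p < 1.
Implicit Types (F S : {set T}) (f g : {set T} -> R) (c : {set T} -> R).

Local Notation v := (p * (1 - p)).

Let p0 : 0 < p. Proof. by case/andP: p01. Qed.
Let q0 : 0 < 1 - p. Proof. by case/andP: p01 => _; rewrite subr_gt0. Qed.
Let v0 : 0 < v. Proof. exact: mulr_gt0. Qed.
Let p01w : 0 <= p <= 1. Proof. by case/andP: p01 => *; rewrite !ltW. Qed.

(* The characters are not normalised: [psi [set x]] has variance [p * (1 - p)], and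
   differentiating along [x] then just drops [x] from the index set. *)
Definition psi S F : R := \prod_(x in S) ((x \in F)%:R - p).
Definition series c F : R := \sum_(S : {set T}) c S * psi S F.
Definition hat f S : R := v ^- #|S| * Ex p (fun F => f F * psi S F).
Definition diff x f F : R := f (x |: F) - f (F :\ x).

(** The reproducing kernel factors over the coordinates: at each one it is the reciprocal of the
    weight if the two sets agree there, and 0 otherwise. *)
Lemma fourier_series f F : f F = series (hat f) F.
Proof.
rewrite /series /hat.
have key G : set_weight p G *
    \sum_(S : {set T}) v ^- #|S| * psi S G * psi S F = (G == F)%:R.
  rewrite (eq_bigr (fun S : {set T} => \prod_(x : T)
     (if x \in S then v^-1 * ((x \in G)%:R - p) * ((x \in F)%:R - p) else 1)));
   last first.
    move=> S _; rewrite -big_mkcond /= !big_split /= prodr_const exprVn //.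
  rewrite -(bigA_distr _ _ (fun x => v^-1 * ((x \in G)%:R - p) * ((x \in F)%:R - p)) (fun=> 1)).
  rewrite /set_weight -big_split /=.
  have [<-|nGF] := eqVneq G F.
    rewrite big1 // => y _; have := lt0r_neq0 p0; have := lt0r_neq0 q0.
    case: (y \in G) => hq hp /=; field; rewrite ?hq ?hp //.
  have /existsP[x xGF] : [exists x, (x \in G) != (x \in F)].
    apply: contraNT nGF => /existsPn xGF; apply/eqP/setP => y.
    by have := xGF y; rewrite negbK => /eqP.
  rewrite (bigD1 x) //=; have := lt0r_neq0 p0; have := lt0r_neq0 q0.
  case: (x \in G) xGF; case: (x \in F) => //= _ hq hp;
  rewrite [X in X * _](_ : _ = 0) ?mul0r //; field; rewrite ?hq ?hp //.
transitivity (\sum_G f G * (set_weight p G *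
    \sum_(S : {set T}) v ^- #|S| * psi S G * psi S F)).
  rewrite (bigD1 F) //= key eqxx mulr1 big1 ?addr0 // => G /negbTE GF.
  by rewrite key GF mulr0.
rewrite (eq_bigr (fun G => \sum_(S : {set T}) f G * (set_weight p G *
   (v ^- #|S| * psi S G * psi S F)))); last first.
  by move=> G _; rewrite -!mulr_sumr.
rewrite exchange_big /=; apply: eq_bigr => S _.
rewrite /Ex mulr_sumr mulr_suml; apply: eq_bigr => G _; ring.
Qed.

(** Expanding [f] alone suffices, because the expectation of [g * psi S] is [hat g S] up to
    [v ^+ #|S|] by definition. *)
Lemma parseval2 f g : Ex p (fun F => f F * g F) =
  \sum_(S : {set T}) hat f S * hat g S * v ^+ #|S|.
Proof.
under eq_Ex => F do rewrite (fourier_series f) /series mulr_suml.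
rewrite Ex_sum; apply: eq_bigr => S _.
have hgE : hat g S * v ^+ #|S| = Ex p (fun F => g F * psi S F).
  by rewrite /hat mulrAC mulVf ?mul1r // expf_neq0 // lt0r_neq0.
by rewrite -mulrA hgE -ExZ; apply: eq_Ex => F; ring.
Qed.

Lemma parseval f : Ex p (fun F => f F ^+ 2) =
  \sum_(S : {set T}) hat f S ^+ 2 * v ^+ #|S|.
Proof. by rewrite -parseval2. Qed.

Lemma psiU x S F : x \notin S -> psi (x |: S) F = ((x \in F)%:R - p) * psi S F.
Proof. by move=> xS; rewrite /psi big_setU1. Qed.

Lemma psi_free x S F G : x \notin S -> F :\ x = G :\ x -> psi S F = psi S G.
Proof.
move=> xS FG; rewrite /psi; apply: eq_bigr => y yS.
have yx : y != x by apply: contraNneq xS => <-.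
by move/setP/(_ y): FG; rewrite !inE yx /= => ->.
Qed.

Lemma setU1D1 x F : (x |: F) :\ x = F :\ x.
Proof. by apply/setP => y; rewrite !inE; case: eqP. Qed.
Lemma setD1D1 x F : (F :\ x) :\ x = F :\ x.
Proof. by apply/setP => y; rewrite !inE; case: eqP. Qed.
Lemma setU1U1 x F : x |: (x |: F) = x |: F.
Proof. by apply/setP => y; rewrite !inE; case: eqP. Qed.
Lemma setU1_D1 x F : x |: (F :\ x) = x |: F.
Proof. by apply/setP => y; rewrite !inE; case: eqP. Qed.

Lemma hat_diff x f S :
  hat (diff x f) S = if x \in S then 0 else hat f (x |: S).
Proof.
case: ifP => xS; rewrite /hat.
  rewrite (Ex_resample p x) (@eq_Ex _ _ _ _ (fun=> 0)) ?Ex_cst ?mulr0 // => F.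
  rewrite -(setD1K xS) !psiU ?inE ?eqxx //= /diff.
  rewrite setU1U1 setU1D1 setU1_D1 setD1D1.
  rewrite (@psi_free x _ (x |: F) (F :\ x)) ?inE ?eqxx ?setU1D1 ?setD1D1 //=.
  ring.
rewrite cardsU1 xS /= add1n exprS invfM .
suff -> : Ex p (fun F => f F * psi (x |: S) F) =
          v * Ex p (fun F => diff x f F * psi S F).
  by rewrite mulrA [v^-1 * _]mulrC mulfVK // lt0r_neq0.
rewrite (Ex_resample p x) [in RHS](Ex_resample p x) -ExZ; apply: eq_Ex => F.
rewrite !psiU ?xS // /diff !inE eqxx /=.
rewrite setU1U1 setU1D1 setU1_D1 setD1D1.
rewrite (@psi_free x _ (x |: F) (F :\ x)) ?xS ?setU1D1 ?setD1D1 //=.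
ring.
Qed.

End Fourier.

(** * Fourth moments in the biased cube, with constants free of [p] *)

Section FourthMoment.
Variables (R : realFieldType) (T : finType) (p : R).
Hypothesis p01 : 0 < p < 1.
Implicit Types (F S : {set T}) (c : {set T} -> R).

Local Notation v := (p * (1 - p)).
Let p0 : 0 < p. Proof. by case/andP: p01. Qed.
Let q0 : 0 < 1 - p. Proof. by case/andP: p01 => _; rewrite subr_gt0. Qed.
Let v0 : 0 < v. Proof. exact: mulr_gt0. Qed.
Let p01w : 0 <= p <= 1. Proof. by case/andP: p01 => *; rewrite !ltW. Qed.

(** The noise operator of parameter [r], acting on Fourier coefficients. *)
Definition damp (r : R) c S := r ^+ #|S| * c S.

(* For [c = hat p f] this is the second moment of the iterated difference of [f]
   along [S]. *)
Definition energy c S : R :=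
  \sum_(U : {set T} | S \subset U) c U ^+ 2 * v ^+ (#|U| - #|S|).

(** The two halves of a function at the coordinate [x]: [without x] holds the coefficients of its
    average over [x], and [link x] those of its derivative along [x]. *)
Definition without x c S : R := if x \in S then 0 else c S.
Definition link x c S : R := if x \in S then 0 else c (x |: S).

Lemma energy_ge0 c S : 0 <= energy c S.
Proof. by apply: sumr_ge0 => U _; rewrite mulr_ge0 ?sqr_ge0 // exprn_ge0 // ltW. Qed.

Lemma series_free x c F G : (forall S, x \in S -> c S = 0) ->
  F :\ x = G :\ x -> series p c F = series p c G.
Proof.
move=> cx FG; apply: eq_bigr => S _; have [xS|xS] := boolP (x \in S).
  by rewrite cx // !mul0r.
by rewrite (psi_free p xS FG).
Qed.

Let series_split x c F :
  series p c F = series p (without x c) F +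
                 ((x \in F)%:R - p) * series p (link x c) F.
Proof.
rewrite /series !(sum_split_at x) mulr_sumr -big_split /=; apply: eq_bigr => S xS.
rewrite /without /link (negbTE xS) !inE eqxx /= !mul0r !addr0 psiU //; ring.
Qed.

Let damp_without x r c : damp r (without x c) =1 without x (damp r c).
Proof. by move=> S; rewrite /damp /without; case: ifP => _ //; rewrite mulr0. Qed.

Let damp_link x r c S : link x (damp r c) S = r * damp r (link x c) S.
Proof.
rewrite /damp /link; case: ifP => xS; first by rewrite !mulr0.
by rewrite cardsU1 xS add1n exprS mulrA.
Qed.

Let eq_series c c' F : c =1 c' -> series p c F = series p c' F.
Proof. by move=> cc; rewrite /series; apply: eq_bigr => S _; rewrite cc. Qed.

Let energyE c S :
  energy c S = \sum_(U : {set T}) if S \subset U then c U ^+ 2 * v ^+ (#|U| - #|S|) else 0.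
Proof. exact: big_mkcond. Qed.

Let energy_split x c S : x \notin S ->
  energy c S = energy (without x c) S + v * energy (link x c) S.
Proof.
move=> xS; rewrite !energyE !(sum_split_at x) mulr_sumr -big_split /=.
apply: eq_bigr => U xU; rewrite /without /link (negbTE xU) !inE eqxx /=.
have -> : (S \subset x |: U) = (S \subset U).
  apply/idP/idP => [/subsetP sub|sub]; last by rewrite subsetU // sub orbT.
  apply/subsetP => y yS; have := sub y yS; rewrite !inE => /orP[/eqP yx|//].
  by move: xS; rewrite -yx yS.
case: ifP => sub; last by rewrite addr0 mulr0 !addr0.
rewrite expr0n /= !mul0r !addr0 cardsU1 xU add1n subSn ?subset_leq_card // (exprS v).
by congr (_ + _); rewrite mulrCA.
Qed.

Lemma energyU x c S : x \notin S -> energy c (x |: S) = energy (link x c) S.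
Proof.
move=> xS; rewrite !energyE !(sum_split_at x) /=.
apply: eq_bigr => U xU; rewrite /link (negbTE xU) !inE eqxx /=.
rewrite expr0n /= !mul0r if_same addr0 !cardsU1 xU xS !add1n subSS.
have -> : (x |: S \subset U) = false.
  by apply/negbTE/negP => /subsetP/(_ x); rewrite !inE eqxx (negbTE xU) => /(_ isT).
rewrite add0r; have -> // : (x |: S \subset x |: U) = (S \subset U).
apply/idP/idP => [/subsetP sub|]; last exact: setUS.
apply/subsetP => y yS; have := sub y; rewrite !inE yS orbT => /(_ isT) /orP[/eqP yx|//].
by move: xS; rewrite -yx yS.
Qed.

Let energy_without x c S : x \in S -> energy (without x c) S = 0.
Proof.
move=> xS; rewrite /energy big1 // => U /subsetP/(_ x xS) xU.
by rewrite /without xU expr0n /= mul0r.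
Qed.

Let energy_link x c S : x \in S -> energy (link x c) S = 0.
Proof.
move=> xS; rewrite /energy big1 // => U /subsetP/(_ x xS) xU.
by rewrite /link xU expr0n /= mul0r.
Qed.

(** One coordinate of the induction. The centred coordinate has fourth moment [v * (1 - 3 * v)],
    which for small [p] is of order [v] and not [v ^+ 2]; hence the weight [v] on the last term,
    which becomes the contribution of the index sets containing the coordinate. *)
Let two_point (e d e' d' : R) :
  p * ((e + (1 - p) * (2^-1 * d)) ^+ 2 * (e' + (1 - p) * (2^-1 * d')) ^+ 2) +
  (1 - p) * ((e + (0 - p) * (2^-1 * d)) ^+ 2 * (e' + (0 - p) * (2^-1 * d')) ^+ 2)
  <= e ^+ 2 * e' ^+ 2 + v * (e ^+ 2 * d' ^+ 2) + v * (d ^+ 2 * e' ^+ 2)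
     + v * (d ^+ 2 * d' ^+ 2).
Proof.
set X := e * d'; set Y := d * e'; set Z := d * d'; set s := 1 - 2 * p.
rewrite -subr_ge0.
(* The gap is [v] times a sum of squares; [s] comes from the third moment [v * s], and the factor
   [2^-1] on the derivatives keeps the last coefficient nonnegative. *)
have -> : e ^+ 2 * e' ^+ 2 + v * (e ^+ 2 * d' ^+ 2) + v * (d ^+ 2 * e' ^+ 2)
     + v * (d ^+ 2 * d' ^+ 2) -
  (p * ((e + (1 - p) * (2^-1 * d)) ^+ 2 * (e' + (1 - p) * (2^-1 * d')) ^+ 2) +
  (1 - p) * ((e + (0 - p) * (2^-1 * d)) ^+ 2 * (e' + (0 - p) * (2^-1 * d')) ^+ 2))
  = v * (2^-1 * (X - Y) ^+ 2 + 8^-1 * (X - s * Z) ^+ 2 + 8^-1 * (Y - s * Z) ^+ 2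
         + 8^-1 * X ^+ 2 + 8^-1 * Y ^+ 2
         + (15 / 16 + 3 / 16 * v - s ^+ 2 / 4) * Z ^+ 2).
  by rewrite /X /Y /Z /s; field.
have s1 : s ^+ 2 <= 1 by rewrite /s; move: (ltW p0) (ltW q0) => *; nra.
have := ltW v0; move=> v0'.
rewrite mulr_ge0 //.
have h : 0 <= 15 / 16 + 3 / 16 * v - s ^+ 2 / 4 by lra.
have := mulr_ge0 h (sqr_ge0 Z).
have := sqr_ge0 (X - Y); have := sqr_ge0 (X - s * Z); have := sqr_ge0 (Y - s * Z).
have := sqr_ge0 X; have := sqr_ge0 Y; lra.
Qed.

(* Bonami's induction, with the energies of all derivatives in place of the
   second moment, so that the constant does not depend on [p].  The statement is
   polarised because the induction on the coordinates mixes the two halves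
   [without x c] and [link x c]. *)
Lemma fourth_moment2 c c' :
  Ex p (fun F => series p (damp 2^-1 c) F ^+ 2 * series p (damp 2^-1 c') F ^+ 2)
  <= \sum_(S : {set T}) v ^+ #|S| * (energy c S * energy c' S).
Proof.
suff gen (A : {set T}) : forall c c',
    (forall S, ~~ (S \subset A) -> c S = 0) ->
    (forall S, ~~ (S \subset A) -> c' S = 0) ->
  Ex p (fun F => series p (damp 2^-1 c) F ^+ 2 * series p (damp 2^-1 c') F ^+ 2)
  <= \sum_(S : {set T}) v ^+ #|S| * (energy c S * energy c' S).
  by apply: (gen setT) => S; rewrite subsetT.
have [m] := ubnP #|A|; elim: m A => // m IH A; rewrite ltnS => Am {}c {}c' cA c'A.
have [A0|[x xA]] := set_0Vmem A.
  have cE b F : (forall S, ~~ (S \subset A) -> b S = 0) ->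
      series p (damp 2^-1 b) F = b set0.
    move=> bA; rewrite /series (bigD1 set0) //= big1 => [|S S0].
      by rewrite /damp /psi big_set0 cards0 mul1r addr0 mulr1.
    by rewrite /damp bA ?mulr0 ?mul0r // A0 subset0.
  under eq_Ex => F do rewrite !cE //.
  rewrite Ex_cst (bigD1 set0) //= cards0 mul1r.
  have en b : b set0 ^+ 2 <= energy b set0.
    rewrite /energy (bigD1 set0) ?sub0set //= subnn mulr1 lerDl.
    by apply: sumr_ge0 => U _; rewrite mulr_ge0 ?sqr_ge0 // exprn_ge0 // ltW.
  rewrite -[leLHS]addr0 lerD //; first by rewrite ler_pM ?sqr_ge0 ?en.
  apply: sumr_ge0 => S _; rewrite mulr_ge0 ?exprn_ge0 ?(ltW v0) //.
  by rewrite mulr_ge0 ?energy_ge0.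
have Ax : (#|A :\ x| < m)%N.
  by move: Am; rewrite [in X in X -> _](cardsD1 x) xA.
pose e := without x c; pose d := link x c.
pose e' := without x c'; pose d' := link x c'.
have suppE b : (forall S, ~~ (S \subset A) -> b S = 0) ->
    forall S, ~~ (S \subset A :\ x) -> without x b S = 0.
  move=> bA S; rewrite subsetD1 negb_and negbK /without.
  by case: ifP => // xS; rewrite orbF => /bA.
have suppD b : (forall S, ~~ (S \subset A) -> b S = 0) ->
    forall S, ~~ (S \subset A :\ x) -> link x b S = 0.
  move=> bA S; rewrite subsetD1 negb_and negbK /link.
  case: ifP => // xS; rewrite orbF => SA; apply: bA.
  by apply: contra SA; apply: subset_trans; apply: subsetUr.
have {IH} IH := IH _ Ax.
have IHee := IH _ _ (suppE _ cA) (suppE _ c'A).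
have IHed := IH _ _ (suppE _ cA) (suppD _ c'A).
have IHde := IH _ _ (suppD _ cA) (suppE _ c'A).
have IHdd := IH _ _ (suppD _ cA) (suppD _ c'A).
pose g b F := series p (damp 2^-1 b) F.
have gw b F G : F :\ x = G :\ x -> g (without x b) F = g (without x b) G.
  by apply: series_free => S xS; rewrite /damp /without xS mulr0.
have gl b F G : F :\ x = G :\ x -> g (link x b) F = g (link x b) G.
  by apply: series_free => S xS; rewrite /damp /link xS mulr0.
have gE b F : g b F = g (without x b) F + ((x \in F)%:R - p) * (2^-1 * g (link x b) F).
  rewrite /g (series_split x); congr (_ + _ * _).
    by apply: eq_series => S; rewrite damp_without.
  by rewrite /series mulr_sumr; apply: eq_bigr => S _; rewrite damp_link -mulrA.
have step : Ex p (fun F => g c F ^+ 2 * g c' F ^+ 2) <=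
    Ex p (fun F => g e F ^+ 2 * g e' F ^+ 2) +
    v * Ex p (fun F => g e F ^+ 2 * g d' F ^+ 2) +
    v * Ex p (fun F => g d F ^+ 2 * g e' F ^+ 2) +
    v * Ex p (fun F => g d F ^+ 2 * g d' F ^+ 2).
  rewrite -!ExZ -!ExD (Ex_resample p x); apply: le_Ex => // F.
  rewrite !(gE c) !(gE c') !inE eqxx /= -/e -/e' -/d -/d'.
  have h1 : (x |: F) :\ x = F :\ x by rewrite setU1D1.
  have h2 : (F :\ x) :\ x = F :\ x by rewrite setD1D1.
  rewrite /e /e' /d /d' !(gw c _ _ h1) !(gl c _ _ h1) !(gw c' _ _ h1) !(gl c' _ _ h1)
    !(gw c _ _ h2) !(gl c _ _ h2) !(gw c' _ _ h2) !(gl c' _ _ h2).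
  exact: two_point.
apply: le_trans step _.
apply: le_trans (lerD (lerD (lerD IHee (ler_wpM2l (ltW v0) IHed))
   (ler_wpM2l (ltW v0) IHde)) (ler_wpM2l (ltW v0) IHdd)) _.
rewrite -/e -/d -/e' -/d' !mulr_sumr -!big_split /= [leRHS](sum_split_at x).
rewrite (bigID (fun S : {set T} => x \in S)) /= big1 ?add0r; last first.
  move=> S xS; rewrite /e /d /e' /d' (energy_without c xS) (energy_link c xS)
    (energy_without c' xS) (energy_link c' xS).
  by rewrite !mul0r !mulr0 !addr0.
(* Splitting both energies at [S] yields the terms [e e'], [e d'] and [d e']; the term [d d'] is
   supplied by the index set [x |: S]. *)
apply: ler_sum => S xS; rewrite !(energyU _ xS) (energy_split c xS) (energy_split c' xS).
rewrite cardsU1 xS add1n exprS -/e -/d -/e' -/d'.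
have : 0 <= v ^+ #|S| * (v ^+ 2 * (energy d S * energy d' S)).
  by rewrite !(mulr_ge0, exprn_ge0, energy_ge0) // ltW.
set a := energy e S; set b := energy d S; set a' := energy e' S; set b' := energy d' S.
set w := v ^+ #|S|; lra.
Qed.

End FourthMoment.

(** * Noise and restrictions *)

Section NoiseBound.
Variables (R : realFieldType) (T : finType) (p : R).
Hypothesis p01 : 0 < p < 1.
Implicit Types (F S U : {set T}) (f : {set T} -> R).

Local Notation v := (p * (1 - p)).
Let p0 : 0 < p. Proof. by case/andP: p01. Qed.
Let q0 : 0 < 1 - p. Proof. by case/andP: p01 => _; rewrite subr_gt0. Qed.
Let v0 : 0 < v. Proof. exact: mulr_gt0. Qed.
Let p01w : 0 <= p <= 1. Proof. by case/andP: p01 => *; rewrite !ltW. Qed.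

Lemma eq_energy c c' S : c =1 c' -> energy p c S = energy p c' S.
Proof. by move=> cc; rewrite /energy; apply: eq_bigr => U _; rewrite cc. Qed.

Lemma energy0 f : energy p (hat p f) set0 = Ex p (fun F => f F ^+ 2).
Proof.
rewrite parseval // /energy; apply: eq_big => [U|U _]; first by rewrite sub0set.
by rewrite cards0 subn0.
Qed.

Lemma hatB f g S : hat p (fun F => f F - g F) S = hat p f S - hat p g S.
Proof.
rewrite /hat -mulrBr -ExB; congr (_ * _); apply: eq_Ex => F; exact: mulrBl.
Qed.

Lemma energy_sub_le c c' S :
  energy p (fun U => c U - c' U) S <= 2 * energy p c S + 2 * energy p c' S.
Proof.
rewrite /energy !mulr_sumr -big_split /=; apply: ler_sum => U _.
rewrite !mulrA -mulrDl ler_wpM2r ?exprn_ge0 ?(ltW v0) //.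
have := sqr_ge0 (c U + c' U); nra.
Qed.

(** The energy at [S] is the second moment of an iterated difference; [(a - b)^2 <= 2 a^2 + 2 b^2]
    replaces each of its differences by two restrictions, at a cost of 4 per coordinate. *)
Lemma energy_hat_le f S M :
  (forall U, U \subset S -> Ex p (fun F => f (U :|: F :\: S) ^+ 2) <= M) ->
  energy p (hat p f) S <= 4 ^+ #|S| * M.
Proof.
have [m] := ubnP #|S|; elim: m S f => // m IH S f; rewrite ltnS => Sm fM.
have [S0|[x xS]] := set_0Vmem S.
  rewrite S0 energy0 cards0 mul1r.
  have := fM set0 (sub0set _); rewrite S0; apply: le_trans.
  by rewrite le_eqVlt; apply/orP; left; apply/eqP/eq_Ex => F; rewrite set0U setD0.
have Sx : (#|S :\ x| < m)%N by move: Sm; rewrite [in X in X -> _](cardsD1 x) xS.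
have -> : energy p (hat p f) S = energy p (hat p (diff x f)) (S :\ x).
  rewrite -[in LHS](setD1K xS) energyU ?inE ?eqxx //; apply: eq_energy => U.
  by rewrite hat_diff.
have -> : energy p (hat p (diff x f)) (S :\ x) = energy p (fun U =>
    hat p (fun F => f (x |: F)) U - hat p (fun F => f (F :\ x)) U) (S :\ x).
  by apply: eq_energy => U; rewrite -hatB.
apply: le_trans (energy_sub_le _ _ _) _.
have -> : 4 ^+ #|S| * M = 2 * (4 ^+ #|S :\ x| * M) + 2 * (4 ^+ #|S :\ x| * M).
  by rewrite [in LHS](cardsD1 x) xS add1n exprS; ring.
rewrite lerD // ler_wpM2l //; apply: IH => // U US.
  have -> : Ex p (fun F => f (x |: (U :|: F :\: (S :\ x))) ^+ 2) =
            Ex p (fun F => f ((x |: U) :|: F :\: S) ^+ 2).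
    apply: eq_Ex => F; congr (f _ ^+ 2); apply/setP => y; rewrite !inE.
    by case: (eqVneq y x) => //= _; rewrite ?orbT.
  by apply: fM; rewrite subUset sub1set xS (subset_trans US) // subD1set.
have -> : Ex p (fun F => f ((U :|: F :\: (S :\ x)) :\ x) ^+ 2) =
          Ex p (fun F => f (U :|: F :\: S) ^+ 2).
  apply: eq_Ex => F; congr (f _ ^+ 2); apply/setP => y; rewrite !inE.
  case: (eqVneq y x) => //= ->; rewrite xS /= orbF; apply/esym/negbTE.
  by apply: contraTN US => xU; apply/subsetPn; exists x; rewrite ?inE ?eqxx.
by apply: fM; apply: subset_trans US (subD1set _ _).
Qed.

Lemma energy_damp_le f S :
  energy p (damp 4^-1 (hat p f)) S <= 16^-1 ^+ #|S| * energy p (hat p f) S.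
Proof.
rewrite /energy mulr_sumr; apply: ler_sum => U SU; rewrite mulrA.
rewrite ler_wpM2r ?exprn_ge0 ?(ltW v0) // /damp exprMn ler_wpM2r ?sqr_ge0 //.
rewrite -exprM mulnC exprM -[4^-1 ^+ 2](_ : 16^-1 = _); last by field.
by rewrite ler_wiXn2l ?subset_leq_card //; lra.
Qed.

(** Each [W] is counted once for every [U] between [S] and [W], at most [2 ^+ #|W|] times, and the
    squared damping [16^-1 ^+ #|W|] outweighs this. *)
Lemma sum_energy_damp_le f S :
  \sum_(U : {set T} | S \subset U) v ^+ #|U| * energy p (damp 4^-1 (hat p f)) U
  <= v ^+ #|S| * energy p (hat p f) S.
Proof.
rewrite /energy.
under eq_bigr => U SU do rewrite mulr_sumr.
rewrite (exchange_big_dep (fun W : {set T} => S \subset W)) /=; last first.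
  by move=> U W SU UW; apply: subset_trans UW.
rewrite mulr_sumr; apply: ler_sum => W SW.
rewrite (eq_bigr (fun=> v ^+ #|W| * damp 4^-1 (hat p f) W ^+ 2)); last first.
  move=> U /andP[SU UW]; rewrite mulrCA -exprD subnKC ?subset_leq_card //.
  exact: mulrC.
have -> : v ^+ #|S| * (hat p f W ^+ 2 * v ^+ (#|W| - #|S|)) = v ^+ #|W| * hat p f W ^+ 2.
  by rewrite mulrCA -exprD subnKC ?subset_leq_card // mulrC.
rewrite sumr_const -[leLHS]mulr_natr -mulrA ler_wpM2l ?exprn_ge0 ?(ltW v0) //.
rewrite /damp exprMn mulrAC -[leRHS]mul1r ler_wpM2r ?sqr_ge0 //.
have mW : (#|(fun U : {set T} => (S \subset U) && (U \subset W))| <= 2 ^ #|W|)%N.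
  rewrite -card_powerset; apply: subset_leq_card; apply/subsetP => U.
  by rewrite powersetE => /andP[].
apply: (@le_trans _ _ (4^-1 ^+ #|W| ^+ 2 * 2 ^+ #|W|)).
  by rewrite ler_wpM2l ?sqr_ge0 // -natrX ler_nat.
rewrite -exprM mulnC exprM -exprMn exprn_ile1 //; lra.
Qed.

(* [a] is global away from [Bad]: fixing few coordinates does not make it much
   more likely.  The sets containing a member of [Bad] are paid for by the
   probability that the member appears. *)
Lemma noise_fourth_moment_le (a : {set T} -> R) (Bad : {set {set T}}) delta m :
  (forall F, 0 <= a F <= 1) -> 2^-1 ^+ m <= delta ->
  (forall S, (#|S| < m)%N -> (forall U, U \in Bad -> ~~ (U \subset S)) ->
     forall U, U \subset S -> Ex p (fun F => a (U :|: F :\: S)) <= 2 ^+ #|S| * delta) ->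
  Ex p (fun F => series p (damp 8^-1 (hat p a)) F ^+ 4) <=
  delta * Ex p a + \sum_(U in Bad) (4 * v) ^+ #|U|.
Proof.
move=> a01 delta_ge small.
have a2 F : a F ^+ 2 <= a F by have /andP[] := a01 F => *; nra.
have delta0 : 0 <= delta by apply: le_trans delta_ge; rewrite exprn_ge0 // invr_ge0.
(* The damping [8^-1] is spent as [2^-1], required by [fourth_moment2], times [4^-1], whose square
   absorbs the factor [4 ^+ #|S|] of [energy_hat_le] and still leaves [4^-1 ^+ #|S|]. *)
pose E S := energy p (damp 4^-1 (hat p a)) S.
have E0 S : 0 <= E S by apply: energy_ge0.
have Ele S M : (forall U, U \subset S -> Ex p (fun F => a (U :|: F :\: S)) <= M) ->
    E S <= 4^-1 ^+ #|S| * M.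
  move=> aM; apply: le_trans (energy_damp_le _ _) _.
  have -> : (4^-1 ^+ #|S| * M : R) = 16^-1 ^+ #|S| * (4 ^+ #|S| * M).
    by rewrite mulrA -exprMn; congr (_ ^+ _ * _); field.
  rewrite ler_wpM2l ?exprn_ge0 ?invr_ge0 //; apply: energy_hat_le => // U US.
  by apply: le_trans (aM U US); apply: le_Ex.
have E1 S : E S <= 4^-1 ^+ #|S|.
  rewrite -[leRHS]mulr1; apply: Ele => U US.
  by rewrite -[leRHS](Ex_cst T p 1); apply: le_Ex => // F; case/andP: (a01 (U :|: F :\: S)).
have q1 S : (4^-1 ^+ #|S| : R) <= 1 by rewrite exprn_ile1 //; lra.
have Esq S : E S * E S <= delta * E S +
    \sum_(U in Bad) (if U \subset S then E S else 0).
  have sum0 : 0 <= \sum_(U in Bad) (if U \subset S then E S else 0).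
    by apply: sumr_ge0 => U _; case: ifP.
  have [/exists_inP[U UB US]|/exists_inPn noBad] := boolP [exists (U | U \in Bad), U \subset S].
    rewrite (bigD1 U) //= US.
    have rest0 : 0 <= \sum_(W in Bad | W != U) (if W \subset S then E S else 0).
      by apply: sumr_ge0 => W _; case: ifP.
    have := E1 S; have := q1 S; have := E0 S; have := mulr_ge0 delta0 (E0 S); nra.
  (* For short [S] globalness gives [4^-1 ^+ #|S| * 2 ^+ #|S| * delta]; for long [S] the damping
     alone is below [2^-1 ^+ m]. *)
  have Ed : E S <= delta.
    have [Sm|mS] := ltnP #|S| m.
      apply: le_trans (Ele S (2 ^+ #|S| * delta) _) _; first exact: small.
      rewrite mulrA -exprMn -[leRHS]mul1r ler_wpM2r // exprn_ile1 //; lra.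
    apply: le_trans (E1 S) (le_trans _ delta_ge).
    apply: (@le_trans _ _ (2^-1 ^+ #|S|)); first by apply: lerXn2r; rewrite ?nnegrE; lra.
    by rewrite ler_wiXn2l //; lra.
  by rewrite -[leLHS]addr0 lerD // ler_wpM2r.
apply: (@le_trans _ _ (\sum_(S : {set T}) v ^+ #|S| * (E S * E S))).
  have := fourth_moment2 p01 (damp 4^-1 (hat p a)) (damp 4^-1 (hat p a)).
  apply: le_trans; rewrite le_eqVlt; apply/orP; left; apply/eqP/eq_Ex => F.
  have -> : series p (damp 2^-1 (damp 4^-1 (hat p a))) F = series p (damp 8^-1 (hat p a)) F.
    rewrite /series; apply: eq_bigr => S _; rewrite /damp mulrA -exprMn.
    by congr (_ ^+ _ * _ * _); field.
  by rewrite -exprD.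
apply: (@le_trans _ _ (\sum_(S : {set T}) (delta * (v ^+ #|S| * E S) +
   \sum_(U in Bad) (if U \subset S then v ^+ #|S| * E S else 0)))).
  apply: ler_sum => S _.
  have := ler_wpM2l (exprn_ge0 #|S| (ltW v0)) (Esq S).
  rewrite [v ^+ _ * (_ + _)]mulrDr [v ^+ _ * \sum_(_ in _) _]mulr_sumr.
  have -> : v ^+ #|S| * (delta * E S) = delta * (v ^+ #|S| * E S) by ring.
  move/le_trans; apply; rewrite lerD2l le_eqVlt; apply/orP; left; apply/eqP.
  by apply: eq_bigr => U _; case: ifP => _ //; rewrite mulr0.
rewrite big_split /= -mulr_sumr lerD //.
  rewrite ler_wpM2l //.
  have := sum_energy_damp_le a set0; rewrite cards0 mul1r energy0.
  under eq_bigl => U do rewrite sub0set.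
  by move/le_trans; apply; apply: le_Ex.
rewrite exchange_big /=; apply: ler_sum => U UB; rewrite -big_mkcond /=.
apply: le_trans (sum_energy_damp_le a U) _.
rewrite [leRHS]exprMn [leRHS]mulrC ler_wpM2l ?exprn_ge0 ?(ltW v0) //.
rewrite -[leRHS]mulr1; apply: energy_hat_le => W WU.
rewrite -[leRHS](Ex_cst T p 1); apply: le_Ex => // F.
by apply: le_trans (a2 _) _; case/andP: (a01 (W :|: F :\: U)).
Qed.

End NoiseBound.

(** * Variance and influences *)

Section Variance.
Variables (R : realFieldType) (T : finType) (p : R).
Hypothesis p01 : 0 < p < 1.
Implicit Types (F S U : {set T}) (f : {set T} -> R).

Local Notation v := (p * (1 - p)).
Let p0 : 0 < p. Proof. by case/andP: p01. Qed.
Let q0 : 0 < 1 - p. Proof. by case/andP: p01 => _; rewrite subr_gt0. Qed.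
Let v0 : 0 < v. Proof. exact: mulr_gt0. Qed.
Let p01w : 0 <= p <= 1. Proof. by case/andP: p01 => *; rewrite !ltW. Qed.

Lemma Ex_mul_series f c :
  Ex p (fun F => f F * series p c F) = \sum_(S : {set T}) hat p f S * c S * v ^+ #|S|.
Proof.
under eq_Ex => F do rewrite /series mulr_sumr.
rewrite Ex_sum; apply: eq_bigr => S _.
have hfE : hat p f S * v ^+ #|S| = Ex p (fun F => f F * psi p S F).
  by rewrite /hat mulrAC mulVf ?mul1r // expf_neq0 // lt0r_neq0.
by rewrite mulrAC hfE mulrC -ExZ; apply: eq_Ex => F; ring.
Qed.

Lemma total_noisy_influence f r :
  \sum_(x : T) v * Ex p (fun F => diff x f F * series p (damp r (hat p (diff x f))) F) =
  \sum_(S : {set T}) (#|S|%:R * r ^+ #|S|.-1) * (hat p f S ^+ 2 * v ^+ #|S|).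
Proof.
transitivity (\sum_(x : T) \sum_(S : {set T})
    if x \in S then r ^+ #|S|.-1 * (hat p f S ^+ 2 * v ^+ #|S|) else 0).
  apply: eq_bigr => x _; rewrite Ex_mul_series mulr_sumr [RHS](sum_split_at x).
  rewrite [LHS](sum_split_at x); apply: eq_bigr => S xS.
  rewrite /damp !(hat_diff p01) !inE eqxx (negbTE xS) /= !mul0r mulr0 addr0 add0r.
  by rewrite cardsU1 xS add1n /= [v ^+ _.+1]exprS; ring.
rewrite exchange_big /=; apply: eq_bigr => S _.
by rewrite -big_mkcond sumr_const -mulrA mulr_natl.
Qed.

(** Undoing the damping on levels 1 to [d] costs at most [8 ^+ d]; on higher levels the undamped
    influences count each weight more than [d] times. *)
Lemma variance_le f d : (0 < d)%N ->
  Ex p (fun F => f F ^+ 2) - Ex p f ^+ 2 <=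
  8 ^+ d * (\sum_(x : T) v * Ex p (fun F =>
              diff x f F * series p (damp 8^-1 (hat p (diff x f))) F)) +
  d%:R^-1 * (\sum_(x : T) v * Ex p (fun F => diff x f F ^+ 2)).
Proof.
move=> d0; rewrite total_noisy_influence.
have -> : \sum_(x : T) v * Ex p (fun F => diff x f F ^+ 2) =
    \sum_(S : {set T}) #|S|%:R * (hat p f S ^+ 2 * v ^+ #|S|).
  transitivity (\sum_(S : {set T}) (#|S|%:R * 1 ^+ #|S|.-1) * (hat p f S ^+ 2 * v ^+ #|S|)).
    rewrite -total_noisy_influence; apply: eq_bigr => x _; congr (_ * _).
    apply: eq_Ex => F; rewrite expr2; congr (_ * _).
    rewrite [LHS](fourier_series p01) /series; apply: eq_bigr => S _.
    by rewrite /damp expr1n mul1r.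
  by apply: eq_bigr => S _; rewrite expr1n mulr1.
rewrite parseval // (bigD1 set0) //= cards0 mulr1.
have -> : hat p f set0 = Ex p f.
  by rewrite /hat cards0 invr1 mul1r; apply: eq_Ex => F; rewrite /psi big_set0 mulr1.
rewrite addrAC subrr add0r !mulr_sumr -big_split /=.
rewrite [leRHS](bigD1 set0) //= cards0 !mul0r !mulr0 !add0r.
apply: ler_sum => S S0.
have w0 : 0 <= hat p f S ^+ 2 * v ^+ #|S|.
  by rewrite mulr_ge0 ?sqr_ge0 ?exprn_ge0 ?(ltW v0).
set w := hat p f S ^+ 2 * v ^+ #|S| in w0 *.
have S1 : (0 < #|S|)%N by rewrite card_gt0.
have -> : 8 ^+ d * (#|S|%:R * 8^-1 ^+ #|S|.-1 * w) + d%:R^-1 * (#|S|%:R * w) =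
  (8 ^+ d * 8^-1 ^+ #|S|.-1 * #|S|%:R + d%:R^-1 * #|S|%:R) * w by ring.
rewrite -[leLHS]mul1r ler_wpM2r //.
have [Sd|dS] := leqP #|S| d.
  have Sd' : (#|S|.-1 <= d)%N by apply: leq_trans Sd; apply: leq_pred.
  apply: (@le_trans _ _ (8 ^+ d * 8^-1 ^+ #|S|.-1 * #|S|%:R)); last first.
    by rewrite lerDl mulr_ge0 ?invr_ge0 ?ler0n.
  rewrite -(subnK Sd') exprD exprVn mulfK ?expf_neq0 ?pnatr_eq0 //.
  by rewrite -natrX -natrM ler1n muln_gt0 expn_gt0 S1.
apply: (@le_trans _ _ (d%:R^-1 * #|S|%:R)); last first.
  by rewrite lerDr !mulr_ge0 ?exprn_ge0 ?invr_ge0 ?ler0n.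
by rewrite mulrC ler_pdivlMr ?ltr0n // mul1r ler_nat ltnW.
Qed.

(** A substitute for Hölder's inequality with a free truncation level: where [g] exceeds [lam], it
    is at most [lam ^- 3 * g ^+ 4]. *)
Lemma truncated_product_le (a g lam : R) : 0 <= a <= 1 -> 0 < lam ->
  a * g <= lam * a + lam ^- 3 * g ^+ 4.
Proof.
move=> /andP[a0 a1] lam0.
have g4 : 0 <= lam ^- 3 * g ^+ 4.
  apply: mulr_ge0; last exact: exprn_even_ge0.
  by rewrite invr_ge0 exprn_ge0 // ltW.
have [gl|lg] := leP g lam.
  by rewrite -[leLHS]addr0 lerD // mulrC ler_wpM2r.
rewrite -[leLHS]add0r lerD ?mulr_ge0 ?(ltW lam0) //.
have g0 : 0 <= g by apply: ltW; apply: lt_trans lg.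
apply: (@le_trans _ _ g); first by rewrite -[leRHS]mul1r ler_wpM2r.
rewrite [_ * g ^+ 4]mulrC ler_pdivlMr ?exprn_gt0 // [g ^+ 4]exprS ler_wpM2l //.
by apply: lerXn2r; rewrite ?nnegrE // ltW.
Qed.

(** Truncation makes the bound linear in the influences, so that the estimates for single
    coordinates add up to [K] and [B]. The level [lam] stays free because it has to beat the factor
    [8 ^+ d]. *)
Lemma variance_le_influence f (Bad : T -> {set {set T}}) d m (lam delta K B : R) :
  (0 < d)%N -> 0 < lam -> 2^-1 ^+ m <= delta ->
  (forall x F, 0 <= diff x f F <= 1) ->
  (forall x S, (#|S| < m)%N -> (forall U, U \in Bad x -> ~~ (U \subset S)) ->
     forall U, U \subset S ->
     Ex p (fun F => diff x f (U :|: F :\: S)) <= 2 ^+ #|S| * delta) ->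
  \sum_(x : T) v * Ex p (diff x f) <= K ->
  \sum_(x : T) v * \sum_(U in Bad x) (4 * v) ^+ #|U| <= B ->
  Ex p (fun F => f F ^+ 2) - Ex p f ^+ 2 <=
  8 ^+ d * (lam * K + lam ^- 3 * (delta * K + B)) + d%:R^-1 * K.
Proof.
move=> d0 lam0 dm f01 small infK BadB.
apply: le_trans (variance_le f d0) _.
apply: lerD; last first.
  rewrite ler_wpM2l ?invr_ge0 ?ler0n //; apply: le_trans infK.
  apply: ler_sum => x _; rewrite ler_wpM2l ?(ltW v0) //; apply: le_Ex => // F.
  by case/andP: (f01 x F) => h0 h1; rewrite -[leRHS]mul1r expr2 ler_wpM2r.
rewrite ler_wpM2l ?exprn_ge0 ?ler0n //.
have delta0 : 0 <= delta by apply: le_trans dm; rewrite exprn_ge0 // invr_ge0.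
apply: (@le_trans _ _ (\sum_(x : T) (lam * (v * Ex p (diff x f)) +
   lam ^- 3 * (delta * (v * Ex p (diff x f)) + v * \sum_(U in Bad x) (4 * v) ^+ #|U|)))).
  apply: ler_sum => x _.
  have -> : lam * (v * Ex p (diff x f)) + lam ^- 3 * (delta * (v * Ex p (diff x f)) +
     v * \sum_(U in Bad x) (4 * v) ^+ #|U|) =
     v * (lam * Ex p (diff x f) + lam ^- 3 * (delta * Ex p (diff x f) +
          \sum_(U in Bad x) (4 * v) ^+ #|U|)) by ring.
  rewrite ler_wpM2l ?(ltW v0) //.
  apply: (@le_trans _ _ (lam * Ex p (diff x f) + lam ^- 3 * Ex p (fun F =>
      series p (damp 8^-1 (hat p (diff x f))) F ^+ 4))).
    rewrite -!ExZ -ExD; apply: le_Ex => // F; exact: truncated_product_le.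
  rewrite lerD2l ler_wpM2l ?invr_ge0 ?exprn_ge0 ?(ltW lam0) //.
  by apply: noise_fourth_moment_le (small x).
have -> : \sum_(x : T) (lam * (v * Ex p (diff x f)) +
   lam ^- 3 * (delta * (v * Ex p (diff x f)) + v * \sum_(U in Bad x) (4 * v) ^+ #|U|)) =
   lam * (\sum_(x : T) v * Ex p (diff x f)) +
   lam ^- 3 * (delta * (\sum_(x : T) v * Ex p (diff x f)) +
               \sum_(x : T) v * \sum_(U in Bad x) (4 * v) ^+ #|U|).
  rewrite big_split /=; congr (_ + _); first by rewrite mulr_sumr.
  by rewrite [delta * _]mulr_sumr -big_split /= mulr_sumr.
apply: lerD; first by apply: ler_wpM2l => //; exact: ltW.
apply: ler_wpM2l; first by rewrite invr_ge0 exprn_ge0 // ltW.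
by apply: lerD => //; apply: ler_wpM2l.
Qed.

End Variance.

(** * Unions, monotonicity and the Russo formula *)

Section Union.
Variables (R : realFieldType) (T : finType).
Implicit Types (p q : R) (F G S : {set T}) (h : {set T} -> R).

(** Two-round exposure: it yields monotonicity in [p], and later allows clauses to be added to a
    formula in rounds. *)
Lemma Ex_union p q h :
  Ex p (fun F => Ex q (fun G => h (F :|: G))) = Ex (1 - (1 - p) * (1 - q)) h.
Proof.
pose ind (W F G : {set T}) : R := \prod_(x : T) ((x \in W) == (x \in F) || (x \in G))%:R.
have indE W F G : ind W F G = (F :|: G == W)%:R.
  rewrite /ind; have [<-|nW] := eqVneq (F :|: G) W.
    by rewrite big1 // => x _; rewrite inE eqxx.
  have /existsP[x xW] : [exists x, (x \in W) != (x \in F :|: G)].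
    apply: contraNT nW => /existsPn nW; apply/eqP/setP => x; apply/esym/eqP.
    by have := nW x; rewrite negbK.
  by rewrite (bigD1 x) //= -in_setU (negbTE xW) mul0r.
have key (W : {set T}) : \sum_(F : {set T}) set_weight p F *
    \sum_(G : {set T}) set_weight q G * ind W F G =
    set_weight (1 - (1 - p) * (1 - q)) W.
  have inner F : \sum_(G : {set T}) set_weight q G * ind W F G =
      \prod_(x : T) (if x \in F then (x \in W)%:R else
         (q * (x \in W)%:R + (1 - q) * (x \notin W)%:R)).
    transitivity (\prod_(x : T) (q * ((x \in W) == (x \in F) || true)%:R +
                    (1 - q) * ((x \in W) == (x \in F) || false)%:R)).
      rewrite bigA_distr; apply: eq_bigr => G _; rewrite /set_weight /ind -big_split /=.
      by apply: eq_bigr => x _; case: ifP.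
    apply: eq_bigr => x _; case: (x \in F); case: (x \in W) => /=; ring.
  transitivity (\prod_(x : T) (p * (x \in W)%:R + (1 - p) *
         (q * (x \in W)%:R + (1 - q) * (x \notin W)%:R))).
    rewrite bigA_distr; apply: eq_bigr => F _; rewrite inner /set_weight -big_split /=.
    by apply: eq_bigr => x _; case: ifP.
  by apply: eq_bigr => x _; case: (x \in W) => /=; ring.
rewrite /Ex; transitivity (\sum_(W : {set T}) (\sum_(F : {set T}) set_weight p F *
    \sum_(G : {set T}) set_weight q G * ind W F G) * h W); last first.
  by apply: eq_bigr => W _; rewrite key.
under [RHS]eq_bigr => W _ do rewrite mulr_suml.
rewrite exchange_big /=; apply: eq_bigr => F _.
under [RHS]eq_bigr => W _ do rewrite -mulrA.
rewrite -mulr_sumr; congr (_ * _).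
under [RHS]eq_bigr => W _ do rewrite mulr_suml.
rewrite exchange_big /=; apply: eq_bigr => G _.
rewrite (bigD1 (F :|: G)) //= indE eqxx mulr1 big1 ?addr0 // => W WFG.
by rewrite indE eq_sym (negbTE WFG) mulr0 mul0r.
Qed.

Lemma Ex_mono h p q : (forall F G, F \subset G -> h F <= h G) ->
  0 <= p -> p <= q -> q <= 1 -> Ex p h <= Ex q h.
Proof.
move=> hmono p0 pq q1.
have [p1|p1] := eqVneq p 1; first by have -> : q = p by lra.
have p1' : 0 < 1 - p by rewrite subr_gt0 lt_neqAle p1; lra.
pose r := 1 - (1 - q) / (1 - p).
have -> : q = 1 - (1 - p) * (1 - r) by rewrite /r; field; rewrite lt0r_neq0.
have r01 : 0 <= r <= 1.
  rewrite /r subr_ge0 ler_pdivrMr // mul1r lerD2l lerN2 pq /=.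
  by rewrite gerBl divr_ge0 ?(ltW p1') ?subr_ge0.
rewrite -Ex_union; apply: le_Ex; first by rewrite p0 (le_trans pq).
by move=> F; rewrite -[leLHS](Ex_cst T r); apply: le_Ex => // G; apply/hmono/subsetUl.
Qed.

End Union.

Section Russo.
Variables (R : realFieldType) (T : finType).
Implicit Types (p : R) (F S : {set T}) (h : {set T} -> R).

Lemma deriv_prod_set (f : T -> {poly R}) (A : {set T}) :
  (\prod_(c in A) f c)^`() = \sum_(c in A) (f c)^`() * \prod_(d in A :\ c) f d.
Proof.
have [m] := ubnP #|A|; elim: m A => // m IH A; rewrite ltnS => Am.
have [->|[x xA]] := set_0Vmem A; first by rewrite !big_set0 derivC.
have Ax : (#|A :\ x| < m)%N by move: Am; rewrite [in X in X -> _](cardsD1 x) xA.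
rewrite (big_setD1 x) //= derivM IH // [RHS](big_setD1 x) //=; congr (_ + _).
rewrite mulr_sumr; apply: eq_bigr => c; rewrite !inE => /andP[cx cA].
rewrite [in RHS](big_setD1 x) /=; last by rewrite !inE eq_sym cx.
rewrite mulrCA; congr (_ * (_ * _)); apply: eq_bigl => y; rewrite !inE.
by rewrite andbCA.
Qed.

(** The expectation as a polynomial in [p], so that derivative and mean value theorem are the
    algebraic ones. *)
Definition Ex_poly h : {poly R} :=
  \sum_(F : {set T}) (\prod_(c in [set: T]) (if c \in F then 'X else 1 - 'X)) * (h F)%:P.

Lemma horner_Ex_poly h p : (Ex_poly h).[p] = Ex p h.
Proof.
rewrite /Ex_poly horner_sum; apply: eq_bigr => F _; rewrite hornerM hornerC horner_prod.
congr (_ * _); rewrite /set_weight; apply: eq_big => [c|c _]; first by rewrite inE.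
by case: ifP => _; rewrite !hornerE.
Qed.

Lemma russo h p : (Ex_poly h)^`().[p] = \sum_(x : T) Ex p (diff x h).
Proof.
pose w x F : R := \prod_(d in [set: T] :\ x) (if d \in F then p else 1 - p).
transitivity (\sum_(F : {set T}) \sum_(x : T)
    (if x \in F then 1 else -1) * w x F * h F).
  rewrite /Ex_poly raddf_sum /= horner_sum; apply: eq_bigr => F _.
  rewrite derivM derivC mulr0 addr0 hornerM hornerC deriv_prod_set horner_sum mulr_suml.
  apply: eq_big => [x|x _]; first by rewrite inE.
  congr (_ * _); rewrite hornerM horner_prod; congr (_ * _).
    by case: ifP => _; rewrite !poly.derivE !hornerE //; ring.
  by apply: eq_bigr => d _; case: ifP => _; rewrite !hornerE.
rewrite exchange_big /=; apply: eq_bigr => x _.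
rewrite /Ex !(sum_split_at x); apply: eq_bigr => F xF.
rewrite /diff !inE eqxx (negbTE xF) setU1K // setUA setUid.
have -> : F :\ x = F by apply/setDidPl; rewrite disjoint_sym disjoints1.
have wU : w x (x |: F) = w x F.
  apply: eq_bigr => d; rewrite !inE => /andP[dx _]; by rewrite (negbTE dx).
have offE (G : {set T}) : \prod_(c | c != x) (if c \in G then p else 1 - p) = w x G.
  by apply: eq_bigl => d; rewrite !inE andbT.
rewrite /set_weight (bigD1 x) //= [in X in _ = _ + X](bigD1 x) //= !offE.
rewrite !inE eqxx (negbTE xF) /= wU; ring.
Qed.

End Russo.

(** * A point of small slope followed by a small increment *)

Section Window.
Variables (R : rcfType) (M : {poly R}).

(** On a grid of mesh [Delta], the increments over two consecutive steps telescope to at most 2 over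
    [J] starting points, so one of them is at most [2 / J]. The mean value theorem in the first of
    its two steps gives [p], and [p + Delta] still lies in the double step. *)
Lemma exists_flat_point (P0 P1 Delta : R) (J : nat) :
  0 < Delta -> (0 < J)%N -> (J%:R + 1) * Delta <= P1 - P0 ->
  (forall x y, P0 <= x -> x <= y -> y <= P1 -> M.[x] <= M.[y]) ->
  (forall x, P0 <= x <= P1 -> 0 <= M.[x] <= 1) ->
  exists p, [/\ P0 < p, p + Delta <= P1, M^`().[p] <= 2 / J%:R / Delta &
             M.[p + Delta] - M.[p] <= 2 / J%:R].
Proof.
move=> D0 J0 JD Mmono M01.
pose t j : R := P0 + j%:R * Delta.
have tle i j : (i <= j)%N -> t i <= t j.
  by move=> ij; rewrite /t lerD2l ler_wpM2r ?ler_nat // ltW.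
have t0 j : P0 <= t j by rewrite -[leLHS]addr0 /t lerD2l mulr_ge0 ?ler0n // ltW.
have tS j : t j.+1 = t j + Delta by rewrite /t -natr1; ring.
have tJ j : (j <= J.+1)%N -> t j <= P1.
  move=> jJ; rewrite /t -lerBrDl; apply: le_trans JD.
  by rewrite ler_wpM2r ?(ltW D0) // natr1 ler_nat.
have J0' : 0 < J%:R :> R by rewrite ltr0n.
have [j jJ Mj] : exists2 j, (j < J)%N & M.[t j.+2] - M.[t j] <= 2 / J%:R.
  have [/existsP[j Mj]|/existsPn noj] := boolP [exists j : 'I_J, M.[t j.+2] - M.[t j] <= 2 / J%:R].
    by exists j.
  exfalso; suff : 2 < 2 :> R by rewrite ltxx.
  apply: (@lt_le_trans _ _ (\sum_(0 <= j < J) (M.[t j.+2] - M.[t j]))).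
    have -> : (2 : R) = \sum_(0 <= j < J) (2 / J%:R).
      rewrite big_mkord sumr_const card_ord -[RHS]mulr_natr mulfVK //; exact: lt0r_neq0.
    rewrite !big_mkord; apply: ltr_sum => [|j _]; last by rewrite ltNge noj.
    by apply/hasP; exists (Ordinal J0); rewrite ?mem_index_enum.
  rewrite (eq_bigr (fun j => (M.[t j.+2] - M.[t j.+1]) + (M.[t j.+1] - M.[t j]))); last first.
    by move=> j _; ring.
  rewrite big_split /= (telescope_sumr (fun j => M.[t j.+1])) // telescope_sumr //.
  have b i : (i <= J.+1)%N -> 0 <= M.[t i] <= 1 by move=> iJ; apply: M01; rewrite t0 tJ.
  have := b J.+1 (leqnn _); have := b J (leqnSn _); have := b 1%N (isT : 0 < J.+1)%N.
  have := b 0%N (isT : 0 <= J.+1)%N; lra.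
have tjS : t j < t j.+1 by rewrite tS ltrDl.
have [p pin Mp] := polyrcf.poly_mvt M tjS.
move: pin; rewrite in_itv /= => /andP[tp pt].
exists p; split.
- exact: le_lt_trans tp.
- by apply: le_trans (tJ j.+2 _) => //; rewrite tS lerD2r ltW.
- rewrite ler_pdivlMr //.
  have <- : t j.+1 - t j = Delta by rewrite tS; ring.
  rewrite -Mp; apply: le_trans Mj; rewrite lerD2r Mmono ?t0 ?tle ?tJ //.
- apply: le_trans Mj; apply: lerB; apply: Mmono => //.
  + by rewrite -[leLHS]addr0 lerD ?(le_trans (t0 j) (ltW tp)) // ltW.
  + by rewrite tS lerD2r ltW.
  + exact: tJ.
  + exact: ltW.
  + by apply: le_trans (ltW pt) (tJ _ _); rewrite ltnW.
Qed.

End Window.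

(** * Clauses and their symmetries *)

Section Clauses.
Variables n k : nat.
Implicit Types (c : nae_clause n k) (x y : assignment n) (S : {set 'I_n})
  (F G : {set nae_clause n k}).

Definition vars c : {set 'I_n} := tag (nae_val c).

Definition same_class S x y :=
  [forall (i | i \in S), x i == y i] || [forall (i | i \in S), x i == ~~ y i].

Lemma card_vars c : #|vars c| = k.
Proof. by case: c => c cP; case/andP: (cP) => /eqP. Qed.

Lemma antipodal_restrict S x y :
  (restrict_to S x \in antipodal_class (restrict_to S y)) = same_class S x y.
Proof.
rewrite !inE /same_class; congr (_ || _).
  apply/eqP/forall_inP => [/ffunP e i iS|e].
    by have := e (exist _ i iS); rewrite !ffunE /= => ->.
  by apply/ffunP => -[i iS]; rewrite !ffunE /=; apply/eqP/e.
apply/eqP/forall_inP => [/ffunP e i iS|e].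
  by have := e (exist _ i iS); rewrite !ffunE /= => ->.
by apply/ffunP => -[i iS]; rewrite !ffunE /=; apply/eqP/e.
Qed.

Lemma local_assignment_extends S (a : local_assignment S) :
  exists y, a = restrict_to S y.
Proof.
exists [ffun i => if insub i is Some u then a u else false].
by apply/ffunP => -[i iS]; rewrite !ffunE /= insubT.
Qed.

Lemma violated_point c : exists y, y \in violated c.
Proof.
case: c => -[S P] cP; case/andP: (cP) => _ /existsP[a /eqP /= Pa].
have [y ay] := local_assignment_extends a.
by exists y; rewrite inE /= Pa ay antipodal_restrict /same_class; apply/orP; left; apply/forall_inP.
Qed.

Lemma tagged_clause c y : y \in violated c ->
  tagged (nae_val c) = antipodal_class (restrict_to (vars c) y).
Proof.
rewrite /vars; case: c => -[S P] cP; case/andP: (cP) => _ /existsP[a /eqP /= Pa].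
rewrite inE /= Pa !inE => /orP[/eqP -> //|/eqP ->].
by rewrite /antipodal_class antipodeK setUC.
Qed.

(** Describes a clause by its variables and one assignment violating it, in place of the dependent
    pair. *)
Lemma violatedE c x y : y \in violated c -> (x \in violated c) = same_class (vars c) x y.
Proof. by move=> yc; rewrite inE (tagged_clause yc) antipodal_restrict. Qed.

Lemma eq_violated c (y z : assignment n) : (forall i, i \in vars c -> y i = z i) ->
  (y \in violated c) = (z \in violated c).
Proof.
move=> yz; have [w wc] := violated_point c; rewrite !(violatedE _ wc) /same_class.
by congr (_ || _); apply: eq_forallb_in => i ic; rewrite yz.
Qed.

Lemma exists_clause S y : #|S| = k -> exists2 c, vars c = S & y \in violated c.
Proof.
move=> Sk.
have cP : is_nae_clause k (existT (fun S : {set 'I_n} => {set local_assignment S}) S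
    (antipodal_class (restrict_to S y))).
  by rewrite /is_nae_clause /= Sk eqxx; apply/existsP; exists (restrict_to S y).
by exists (NaeClause cP) => //; rewrite !inE eqxx.
Qed.

Lemma eq_clause c1 c2 y : vars c1 = vars c2 ->
  y \in violated c1 -> y \in violated c2 -> c1 = c2.
Proof.
move=> vE /tagged_clause t1 /tagged_clause t2; apply: val_inj => /=.
move: vE t1 t2; rewrite /vars; case: (nae_val c1) => S1 P1; case: (nae_val c2) => S2 P2 /=.
by move=> SE; subst S2 => -> ->.
Qed.

Definition sol F : {set assignment n} := [set x | [forall (c | c \in F), x \notin violated c]].

Lemma in_solP F x : reflect (forall c, c \in F -> x \notin violated c) (x \in sol F).
Proof. rewrite inE; exact: forall_inP. Qed.

Lemma in_nae_cover F : (F \in nae_cover n k) = (sol F == set0).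
Proof.
rewrite inE; apply/eqP/eqP => [cov|sol0].
  apply/setP => x; rewrite in_set0; apply/negP => /in_solP xs.
  have : x \in [set: assignment n] by rewrite inE.
  by rewrite -cov => /bigcupP[c cF]; rewrite (negbTE (xs c cF)).
apply/setP => x; rewrite !inE; apply/bigcupP; apply/exists_inP.
apply: contraT => /exists_inPn xs; have : x \in sol F by apply/in_solP.
by rewrite sol0 inE.
Qed.

Lemma solU F G : sol (F :|: G) = sol F :&: sol G.
Proof.
apply/setP => x; rewrite in_setI; apply/in_solP/andP => [h|[/in_solP h1 /in_solP h2] c].
  by split; apply/in_solP => c cF; apply: h; rewrite inE cF ?orbT.
by rewrite inE => /orP[/h1|/h2].
Qed.

Lemma solS F G : F \subset G -> sol G \subset sol F.
Proof. by move/setUidPr <-; rewrite solU subsetIl. Qed.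

End Clauses.

Section Symmetry.
Variables n k : nat.
Variables (pi : {perm 'I_n}) (tau : assignment n).
Implicit Types (c : nae_clause n k) (x y : assignment n) (S : {set 'I_n})
  (F : {set nae_clause n k}).

Definition cube_act x : assignment n := [ffun i => x (pi i) (+) tau i].

Lemma cube_act_inj : injective cube_act.
Proof.
move=> x y /ffunP e; apply/ffunP => i; have := e ((pi^-1)%g i).
by rewrite !ffunE permKV => /addIb.
Qed.

(** The image clause is picked by its characteristic property, which avoids transporting local
    assignments; [clause_actP] shows that the property can always be met, so that the default [c] is
    harmless. *)
Definition clause_act c : nae_clause n k :=
  odflt c [pick d | (vars d == pi @^-1: vars c) &&
    [forall (y | y \in violated c), cube_act y \in violated d]].

Lemma same_class_act S x y :
  same_class (pi @^-1: S) (cube_act x) (cube_act y) = same_class S x y.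
Proof.
rewrite /same_class; congr (_ || _).
  apply/forall_inP/forall_inP => e i iS.
    have := e ((pi^-1)%g i); rewrite !inE permKV => /(_ iS).
    by rewrite !ffunE permKV => /eqP/addIb ->.
  by rewrite inE in iS; rewrite !ffunE (eqP (e _ iS)).
apply/forall_inP/forall_inP => e i iS.
  have := e ((pi^-1)%g i); rewrite !inE permKV => /(_ iS).
  by rewrite !ffunE permKV -addNb => /eqP/addIb ->.
by rewrite inE in iS; rewrite !ffunE (eqP (e _ iS)) addNb.
Qed.

Lemma clause_actP c : vars (clause_act c) = pi @^-1: vars c /\
  (forall x, (cube_act x \in violated (clause_act c)) = (x \in violated c)).
Proof.
have [y yc] := violated_point c.
have card_pre : #|pi @^-1: vars c| = k.
  by apply: etrans (card_vars c); apply/card_preimset/perm_inj.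
rewrite /clause_act; case: pickP => [d /andP[/eqP vd /forall_inP dP]|/= none].
  split=> // x; rewrite (violatedE _ (dP y yc)) vd same_class_act.
  by rewrite (violatedE _ yc).
have [d vd yd] := exists_clause (cube_act y) card_pre.
have := none d; rewrite vd eqxx /= => /negbT/forall_inPn[z zc].
by rewrite (violatedE _ yd) vd same_class_act -(violatedE _ yc) zc.
Qed.

Lemma clause_act_inj : injective clause_act.
Proof.
move=> c1 c2 e; have [v1 a1] := clause_actP c1; have [v2 a2] := clause_actP c2.
have [y yc] := violated_point c1.
apply: (@eq_clause _ _ _ _ y) => //; last by rewrite -a2 -e a1.
apply/setP => i; have : (pi^-1)%g i \in vars (clause_act c1) = ((pi^-1)%g i \in vars (clause_act c2)).
  by rewrite e.
by rewrite v1 v2 !inE permKV.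
Qed.

Lemma sol_act F x : (cube_act x \in sol (clause_act @: F)) = (x \in sol F).
Proof.
apply/in_solP/in_solP => [h c cF|h d /imsetP[c cF ->]].
  by have [_ <-] := clause_actP c; apply/h/imset_f.
by have [_ ->] := clause_actP c; apply: h.
Qed.

End Symmetry.

Lemma Ex_injection (R : realFieldType) (T : finType) (p : R) (h : {set T} -> R) (phi : T -> T) :
  injective phi -> Ex p (fun F => h (phi @: F)) = Ex p h.
Proof.
move=> phi_inj.
have [psi psiK phiK] : bijective phi := injF_bij phi_inj.
rewrite /Ex [RHS](reindex (fun F : {set T} => phi @: F)) /=; last first.
  exists (fun F : {set T} => psi @: F) => F _.
    by rewrite -imset_comp (eq_imset _ psiK) imset_id.
  by rewrite -imset_comp (eq_imset _ phiK) imset_id.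
apply: eq_bigr => F _; congr (_ * _); rewrite /set_weight.
rewrite [RHS](reindex phi) /=; last by exists psi => c _; [apply: psiK|apply: phiK].
by apply: eq_bigr => c _; rewrite mem_imset.
Qed.

(** * Literals and the killing probability *)

Section Literals.
Variable n : nat.
Implicit Types (x y : assignment n) (S : {set assignment n}).

Definition literal := ('I_n * bool)%type.
Definition fits (l : seq literal) x := all (fun a => x a.1 == a.2) l.
Definition cut S (l : seq literal) : {set assignment n} := [set x in S | fits l x].

Lemma cut_nil S : cut S [::] = S.
Proof. by apply/setP => x; rewrite inE andbT. Qed.

Lemma cut_rcons S l a : cut S (rcons l a) = cut (cut S l) [:: a].
Proof. by apply/setP => x; rewrite !inE /fits all_rcons /= andbT andbAC andbA. Qed.

(** Both lists of variables extend to enumerations of all variables; matching the enumerations gives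
    the permutation, and the flips then correct the signs. *)
Lemma literals_act (l l' : seq literal) : size l = size l' ->
  uniq (map fst l) -> uniq (map fst l') ->
  exists pi : {perm 'I_n}, exists tau : assignment n,
    forall x, fits l' (cube_act pi tau x) = fits l x.
Proof.
move=> sz ul ul'.
pose ext (s : seq 'I_n) := s ++ [seq i <- enum 'I_n | i \notin s].
have ext_uniq s : uniq s -> uniq (ext s).
  move=> us; rewrite cat_uniq us filter_uniq ?enum_uniq // andbT.
  by apply/hasPn => i; rewrite mem_filter => /andP[].
have ext_mem s i : i \in ext s.
  by rewrite mem_cat mem_filter mem_enum andbT; case: (i \in s).
have ext_size s : uniq s -> size (ext s) = n.
  move=> us; rewrite -[RHS]card_ord cardE; apply/perm_size/uniq_perm.
  - exact: ext_uniq.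
  - exact: enum_uniq.
  - by move=> i; rewrite ext_mem mem_enum.
set s := map fst l; set s' := map fst l'.
pose f i := nth i (ext s) (index i (ext s')).
have f_inj : injective f.
  move=> i j; rewrite /f => e.
  have szE : size (ext s') = size (ext s) by rewrite !ext_size.
  have hi : (index i (ext s') < size (ext s))%N by rewrite -szE index_mem ext_mem.
  have hj : (index j (ext s') < size (ext s))%N by rewrite -szE index_mem ext_mem.
  move: e; rewrite (set_nth_default j i) // => /eqP.
  rewrite nth_uniq ?ext_uniq // => /eqP e.
  by rewrite -(nth_index i (ext_mem s' i)) e nth_index ?ext_mem.
pose sgn (t : seq literal) i := nth false (map snd t) (index i (map fst t)).
pose pi := perm f_inj.
exists pi, [ffun i => sgn l (pi i) (+) sgn l' i] => x.
have fitsE t y : uniq (map fst t) -> fits t y = all (fun i => y i == sgn t i) (map fst t).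
  rewrite /fits /sgn; elim: t => //= a t IH /andP[aN ut]; rewrite eqxx /= IH //.
  congr (_ && _); apply: eq_in_all => i it /=.
  by case: (eqVneq a.1 i) aN => // ->; rewrite it.
rewrite !fitsE // -/s -/s'.
have fs j : (j < size s)%N -> forall i0, pi (nth i0 s' j) = nth i0 s j.
  move=> js i0; rewrite permE /f /ext.
  have js' : (j < size s')%N by rewrite size_map -sz -(size_map fst).
  rewrite index_cat mem_nth // index_uniq // nth_cat js.
  exact: set_nth_default.
have szs : size s = size s' by rewrite !size_map.
have sE : map pi s' = s.
  case E: s => [|i0 s0]; first by apply/size0nil; rewrite size_map -szs E.
  rewrite -E; apply: (@eq_from_nth _ i0) => [|j]; rewrite size_map // => js'.
  by rewrite (nth_map i0) // fs // szs.
rewrite -sE (all_map pi); apply: eq_all => i /=.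
by rewrite !ffunE; case: (x (pi i)); case: (sgn l (pi i)); case: (sgn l' i).
Qed.

End Literals.

Lemma Ex_disjoint (R : realFieldType) (T : finType) (p : R) (A : {set T}) :
  Ex p (fun F => (F :&: A == set0)%:R) = (1 - p) ^+ #|A|.
Proof.
transitivity (\prod_(x : T) (p * (x \notin A)%:R + (1 - p))).
  rewrite bigA_distr; apply: eq_bigr => F _; rewrite /set_weight.
  have [/eqP|/set0Pn[x]] := boolP (F :&: A == set0).
    move=> FA; rewrite mulr1; apply: eq_bigr => x _; case: ifP => // xF.
    suff -> : x \notin A by rewrite mulr1.
    by move/setP/(_ x): FA; rewrite !inE xF /= => ->.
  rewrite inE => /andP[xF xA]; rewrite mulr0 [RHS](bigD1 x) //= xF xA /=.
  by rewrite mulr0 mul0r.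
rewrite -prodr_const [RHS]big_mkcond /=; apply: eq_bigr => x _.
by case: (x \in A); rewrite /= ?mulr0 ?add0r // mulr1 addrC subrK.
Qed.

Section Kill.
Variables (R : realFieldType) (n k : nat).
Implicit Types (p : R) (S : {set assignment n}) (F G : {set nae_clause n k}).

(* The probability that [r] independent uniform literals have no common
   solution in [S] (for [n = 0] and [r > 0] it is the junk value 0). *)
Fixpoint kill r S : R :=
  if r is r'.+1 then (2 * n%:R)^-1 * \sum_(a : literal n) kill r' (cut S [:: a])
  else (S == set0)%:R.

Lemma card_literal : #|{: literal n}| = (2 * n)%N.
Proof. by rewrite card_prod card_ord card_bool mulnC. Qed.

Lemma kill_ge0 r S : 0 <= kill r S.
Proof.
elim: r S => [|r IH] S /=; first exact: ler0n.
by rewrite mulr_ge0 ?invr_ge0 ?mulr_ge0 ?ler0n // sumr_ge0.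
Qed.

Lemma kill_le1 r S : kill r S <= 1.
Proof.
elim: r S => [|r IH] S /=; first by rewrite lern1; case: eqP.
case: (posnP n) => [n0|n0].
  by rewrite [X in (2 * X%:R)^-1]n0 mulr0 invr0 mul0r.
rewrite mulrC ler_pdivrMr ?mulr_gt0 ?ltr0n // mul1r.
apply: (@le_trans _ _ (\sum_(a : literal n) 1)); first exact: ler_sum.
by rewrite sumr_const card_literal natrM.
Qed.

Definition kills p l : R := Ex p (fun F =>
  ((sol F != set0) && (cut (sol F) l == set0))%:R).

Lemma kills_symmetric p l l' : size l = size l' ->
  uniq (map fst l) -> uniq (map fst l') -> kills p l = kills p l'.
Proof.
move=> sz ul ul'; have [pi [tau act]] := literals_act sz ul ul'.
rewrite /kills -[RHS](Ex_injection p _ (@clause_act_inj n k pi tau)).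
apply: eq_Ex => F; congr (nat_of_bool _)%:R.
have [g gK Kg] : bijective (cube_act pi tau) := injF_bij (@cube_act_inj _ pi tau).
congr (~~ _ && _).
  apply/eqP/eqP => s0; apply/setP => x; rewrite in_set0.
    by rewrite -(Kg x) sol_act s0 in_set0.
  by rewrite -(sol_act pi tau) s0 in_set0.
have mem_cut S' t x : (x \in cut S' t) = (x \in S') && fits t x by rewrite inE.
apply/eqP/eqP => s0; apply/setP => x; rewrite in_set0 mem_cut.
  move/setP/(_ (g x)): s0; rewrite in_set0 mem_cut -[in X in X -> _](act (g x)) Kg.
  by rewrite -(sol_act pi tau) Kg.
by move/setP/(_ (cube_act pi tau x)): s0; rewrite in_set0 mem_cut act sol_act.
Qed.

(** The literals are drawn one at a time. As long as at most half of the variables are used, at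
    least half of the literals lie on a fresh variable, so that keeping the variables distinct costs
    a factor 2 per draw. *)
Lemma kill_spread p delta m r l : 0 <= p <= 1 -> (2 * m <= n)%N -> (0 < n)%N ->
  (size l + r = m)%N -> uniq (map fst l) ->
  (forall l', size l' = m -> uniq (map fst l') -> delta <= kills p l') ->
  0 <= delta ->
  2^-1 ^+ r * delta <= Ex p (fun F => (sol F != set0)%:R * kill r (cut (sol F) l)).
Proof.
move=> p01 mn n0 + + hm delta0.
elim: r l => [|r IH] l slm ul.
  rewrite mul1r; apply: le_trans (hm l _ ul) _; first by rewrite -slm addn0.
  by apply: le_Ex => // F /=; rewrite -natrM mulnb.
have step : Ex p (fun F => (sol F != set0)%:R * kill r.+1 (cut (sol F) l)) =
   (2 * n%:R)^-1 * \sum_(a : literal n)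
     Ex p (fun F => (sol F != set0)%:R * kill r (cut (sol F) (rcons l a))).
  rewrite -Ex_sum -ExZ; apply: eq_Ex => F /=; rewrite mulrCA mulr_sumr.
  by congr (_ * _); apply: eq_bigr => a _; rewrite cut_rcons.
rewrite step [leRHS]mulrC ler_pdivlMr ?mulr_gt0 ?ltr0n //.
apply: (@le_trans _ _ (\sum_(a : literal n | a.1 \notin map fst l) 2^-1 ^+ r * delta)).
  rewrite sumr_const -[leRHS]mulr_natl.
  have -> : 2^-1 ^+ r.+1 * delta * (2 * n%:R) = n%:R * (2^-1 ^+ r * delta).
    by rewrite exprS; field.
  rewrite ler_wpM2r ?mulr_ge0 ?exprn_ge0 ?invr_ge0 // ler_nat.
  pose V := [set i | i \notin map fst l].
  have Vl : (n - size l <= #|V|)%N.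
    have -> : V = ~: [set i in map fst l] by apply/setP => i; rewrite !inE.
    rewrite cardsCs setCK card_ord leq_sub2l // cardsE.
    by apply: leq_trans (card_size _) _; rewrite size_map.
  apply: (@leq_trans #|setX V [set: bool]|).
    rewrite cardsX cardsT card_bool; lia.
  by apply: subset_leq_card; apply/subsetP => -[i b]; rewrite inE /= !inE andbT.
rewrite big_mkcond; apply: ler_sum => a _; case: ifP => al; last first.
  by apply: Ex_ge0 => // F; rewrite mulr_ge0 ?ler0n ?kill_ge0.
apply: IH; first by rewrite size_rcons -slm addSnnS.
by rewrite map_rcons rcons_uniq al.
Qed.

(** The rate of the union of [r] independent [p]-random sets. *)
Fixpoint union_rate p r : R := if r is r'.+1 then 1 - (1 - p) * (1 - union_rate p r') else 0.

Lemma union_rate_itv p r : 0 <= p <= 1 -> 0 <= union_rate p r <= 1.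
Proof.
move=> /andP[p0 p1]; elim: r => [|r /andP[r0 r1]] /=; first by rewrite lexx ler01.
apply/andP; split; nra.
Qed.

Lemma union_rate_le p r : 0 <= p <= 1 -> union_rate p r <= r%:R * p.
Proof.
move=> p01; elim: r => [|r IH] /=; first by rewrite mul0r.
have /andP[r0 r1] := union_rate_itv r p01; case/andP: p01 => p0 p1.
rewrite -natr1; nra.
Qed.

(** A literal is good if fixing it keeps the killing probability at least [q]. By averaging, at
    least [2 n q] literals are good, hence at least [n q] variables carry one, and [b] selects its
    sign. A clause inside [V] violated by the complement [y] of [b] can only be satisfied by
    agreeing with [b] on one of its variables. *)
Lemma exists_killing_clauses r S (q : R) : (1 < k)%N -> (0 < n)%N -> 0 <= q ->
  2 * q <= kill r.+1 S ->
  exists (A : {set nae_clause n k}) (b : {ffun 'I_n -> bool}) (V : {set 'I_n}),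
   [/\ (forall i, i \in V -> q <= kill r (cut S [:: (i, b i)])),
       n%:R * q <= #|V|%:R,
       (forall c, c \in A -> vars c \subset V /\
          forall x, x \notin violated c -> exists2 i, i \in vars c & x i = b i) &
       ('C(#|V|, k) <= #|A|)%N].
Proof.
move=> k1 n0 q0 Sq.
pose good (a : literal n) := q <= kill r (cut S [:: a]).
pose b := [ffun i : 'I_n => good (i, true)].
pose V := [set i : 'I_n | good (i, true) || good (i, false)].
pose y : assignment n := [ffun i => ~~ b i].
pose A := [set c : nae_clause n k | (vars c \subset V) && (y \in violated c)].
exists A, b, V; split.
- by move=> i; rewrite inE /b ffunE; case E: (good (i, true)).
- have n0' : 0 < 2 * n%:R :> R by rewrite mulr_gt0 ?ltr0n.
  move: Sq => /=; rewrite mulrC [leRHS]mulrC ler_pdivlMr // => Sq.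
  have h : \sum_(a : literal n) kill r (cut S [:: a]) <=
      \sum_(a : literal n) (q + (good a)%:R).
    apply: ler_sum => a _; case E: (good a).
      by apply: le_trans (kill_le1 _ _) _; rewrite lerDr.
    by rewrite addr0 ltW // ltNge -/(good a) E.
  have g2 : \sum_(a : literal n) (good a)%:R <= 2 * #|V|%:R :> R.
    have -> : \sum_(a : literal n) (good a)%:R = #|[set a | good a]|%:R :> R.
      by rewrite -natr_sum -big_mkcond /= sum1dep_card.
    rewrite -natrM ler_nat.
    have -> : (2 * #|V| = #|setX V [set: bool]|)%N by rewrite cardsX cardsT card_bool mulnC.
    apply: subset_leq_card; apply/subsetP => -[i c]; rewrite !inE /= andbT.
    by case: c => ->; rewrite ?orbT.
  move: h; rewrite big_split /= sumr_const card_literal -[q *+ _]mulr_natl natrM; lra.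
- move=> c; rewrite inE => /andP[cV yc]; split=> // x; rewrite (violatedE _ yc) negb_or.
  case/andP=> /forall_inPn[i ic xi] _; exists i => //.
  by move: xi; rewrite !ffunE; case: (x i); case: (good _).
- rewrite -cards_draws.
  pose D := [set B : {set 'I_n} | B \subset V & #|B| == k].
  have DA : D \subset [set vars c | c in A].
    apply/subsetP => B; rewrite inE => /andP[BV /eqP Bk].
    have [c cB yc] := exists_clause y Bk.
    by apply/imsetP; exists c => //; rewrite /A inE cB BV yc.
  by apply: leq_trans (subset_leq_card DA) (leq_imset_card _ _).
Qed.

(* A clause all of whose literals are good replaces one random literal: a
   solution satisfying it makes one of these [k] literals true, and the same
   further clauses serve all [k] branches, up to a union bound. *)
Lemma amplify r S (p q beta : R) : (1 < k)%N -> (0 < n)%N -> 0 < q -> 0 <= p <= 1 ->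
  (forall m, n%:R * q <= m%:R -> (1 - p) ^+ 'C(m, k) <= beta) ->
  2 ^+ r * q <= kill r S ->
  Ex (union_rate p r) (fun G => (S :&: sol G != set0)%:R) <= r%:R * k%:R ^+ r * beta.
Proof.
move=> k1 n0 q0 p01 pbeta.
have /andP[p0 p1] := p01.
elim: r S => [|r IH] S.
  rewrite mul1r /= => Sq; have -> : S = set0.
    by apply/eqP; apply: contraTT Sq => /negbTE ->; rewrite -ltNge.
  rewrite !mul0r (@eq_Ex _ _ _ _ (fun=> 0)) ?Ex_cst // => G.
  by rewrite set0I eqxx.
rewrite exprS -mulrA => Sq.
have q'0 : 0 <= 2 ^+ r * q by rewrite mulr_ge0 ?exprn_ge0 // ltW.
have [A [b [V [Vgood nV Ac AV]]]] := exists_killing_clauses k1 n0 q'0 Sq.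
have qq' : q <= 2 ^+ r * q.
  by rewrite -[leLHS]mul1r ler_wpM2r ?(ltW q0) // exprn_ege1 // ler1n.
have Abeta : (1 - p) ^+ #|A| <= beta.
  apply: le_trans (pbeta #|V| _).
    by rewrite ler_wiXn2l ?subr_ge0 // gerBl.
  by apply: le_trans nV; rewrite ler_wpM2l.
have beta0 : 0 <= beta by apply: le_trans Abeta; rewrite exprn_ge0 // subr_ge0.
have ur01 := union_rate_itv r p01.
rewrite /= -Ex_union.
(* Missing [A] in the first round costs [beta], and hitting it leaves [k] branches for the other [r]
   rounds: the recursion behind [r * k ^ r * beta]. *)
apply: (@le_trans _ _ (Ex p (fun G1 => (G1 :&: A == set0)%:R +
    k%:R * (r%:R * k%:R ^+ r * beta)))); last first.
  rewrite ExD Ex_disjoint Ex_cst -natr1 exprS.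
  have : 1 * beta <= k%:R * k%:R ^+ r * beta.
    by rewrite ler_wpM2r // -exprS exprn_ege1 // ler1n ltnW.
  rewrite mul1r => h.
  have -> : (r%:R + 1) * (k%:R * k%:R ^+ r) * beta =
    k%:R * k%:R ^+ r * beta + k%:R * (r%:R * k%:R ^+ r * beta) by ring.
  by rewrite lerD2r; apply: le_trans h.
apply: le_Ex => // G1.
have bnd0 : 0 <= k%:R * (r%:R * k%:R ^+ r * beta) by rewrite !mulr_ge0 ?exprn_ge0.
have [_|/set0Pn[c]] := boolP (G1 :&: A == set0).
  apply: (@le_trans _ _ 1); last by rewrite lerDl.
  rewrite -[leRHS](Ex_cst (nae_clause n k) (union_rate p r) 1).
  by apply: le_Ex => // G2; rewrite lern1 leq_b1.
rewrite inE => /andP[cG cA]; rewrite add0r.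
have [cV cb] := Ac c cA.
apply: (@le_trans _ _ (\sum_(i in vars c) Ex (union_rate p r) (fun G2 =>
    (cut S [:: (i, b i)] :&: sol G2 != set0)%:R))).
  rewrite -Ex_sum; apply: le_Ex => // G2.
  case: eqVneq => [_|/set0Pn[x]]; first by apply: sumr_ge0 => i _; apply: ler0n.
  rewrite solU !inE => /andP[xS /andP[x1 x2]].
  have [i ic xi] : exists2 i, i \in vars c & x i = b i.
    by apply: cb; apply: (forall_inP x1).
  rewrite (bigD1 i) //=; have -> : cut S [:: (i, b i)] :&: sol G2 != set0.
    by apply/set0Pn; exists x; rewrite !inE /= xS xi eqxx x2.
  by rewrite lerDl; apply: sumr_ge0 => j _; apply: ler0n.
apply: (@le_trans _ _ (\sum_(i in vars c) r%:R * k%:R ^+ r * beta)).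
  by apply: ler_sum => i ic; apply: IH; apply: Vgood; apply: (subsetP cV).
by rewrite sumr_const card_vars -[leLHS]mulr_natl.
Qed.

End Kill.

(** * Restricted pivotality *)

(** With probability [(1 - p) ^+ #|S|], independently of the rest, [F] avoids [S] and equals
    [F :\: S]. *)
Lemma Ex_setD (R : realFieldType) (T : finType) (p : R) (h : {set T} -> R) (S : {set T}) :
  0 <= p <= 1 -> (forall F, 0 <= h F) ->
  (1 - p) ^+ #|S| * Ex p (fun F => h (F :\: S)) <= Ex p h.
Proof.
move=> p01 h0; have /andP[p0 p1] := p01.
have [m] := ubnP #|S|; elim: m S => // m IH S; rewrite ltnS => Sm.
have [->|[x xS]] := set_0Vmem S.
  by rewrite cards0 mul1r; apply: le_Ex => // F; rewrite setD0.
have Sx : (#|S :\ x| < m)%N by move: Sm; rewrite [in X in X -> _](cardsD1 x) xS.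
apply: le_trans (IH _ Sx).
rewrite [in leLHS](cardsD1 x) xS add1n exprSr -mulrA ler_wpM2l ?exprn_ge0 ?subr_ge0 //.
rewrite [leRHS](Ex_resample p x) -ExZ; apply: le_Ex => // F.
have -> : (F :\ x) :\: (S :\ x) = F :\: S.
  by apply/setP => y; rewrite !inE; case: eqVneq => [->|] //=; rewrite xS.
by rewrite lerDr mulr_ge0.
Qed.

Lemma exists_distinct_superset n (V : {set 'I_n}) a : (#|V| <= a <= n)%N ->
  exists s : seq 'I_n, [/\ uniq s, size s = a & {subset V <= s}].
Proof.
move=> /andP[Va an]; exists (take a (enum V ++ enum (~: V))); split.
- apply: take_uniq; rewrite cat_uniq !enum_uniq /= andbT.
  by apply/hasPn => i; rewrite !mem_enum inE.
- by rewrite size_takel // size_cat -!cardE cardsC card_ord.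
- by move=> i iV; rewrite take_cat -cardE ltnNge Va /= mem_cat mem_enum iV.
Qed.

Section Unsat.
Variables (R : realFieldType) (n k : nat).
Implicit Types (p : R) (x c : nae_clause n k) (S F G U W : {set nae_clause n k}).

Definition unsat F : R := (sol F == set0)%:R.

Lemma sol_sub0 F G : F \subset G -> sol F = set0 -> sol G = set0.
Proof. by move=> FG F0; apply/eqP; rewrite -subset0 -F0 solS. Qed.

Lemma unsat_mono F G : F \subset G -> unsat F <= unsat G.
Proof.
move=> FG; rewrite /unsat ler_nat; case: eqP => // /(sol_sub0 FG) ->.
by rewrite eqxx.
Qed.

Lemma diff_unsatE x F :
  diff x unsat F = ((sol (F :\ x) != set0) && (sol (x |: F) == set0))%:R.
Proof.
rewrite /diff /unsat; case: (eqVneq (sol (F :\ x)) set0) => [F0|_]; last by rewrite subr0.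
have FU : F :\ x \subset x |: F by apply: subset_trans (subD1set _ _) (subsetUr _ _).
by rewrite (sol_sub0 FU F0) eqxx subrr.
Qed.

Lemma diff_unsat_itv x F : 0 <= diff x unsat F <= 1.
Proof. by rewrite diff_unsatE ler0n lern1 leq_b1. Qed.

Definition minunsat W := minset (fun W' => sol W' == set0) W.

(** The small obstructions to the globalness of [diff x unsat]: once [U] is present, [x] completes a
    minimal unsatisfiable formula. *)
Definition blocking (m : nat) x : {set {set nae_clause n k}} :=
  [set U : {set nae_clause n k} | [&& x \notin U, (#|U| < m)%N & minunsat (x |: U)]].

Lemma card_all_vars U : (#|\bigcup_(c in U) vars c| <= #|U| * k)%N.
Proof.
have -> : (#|U| * k = \sum_(c in U) #|vars c|)%N.
  by rewrite -sum_nat_const; apply: eq_bigr => c _; rewrite card_vars.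
apply: (big_ind2 (fun (A : {set 'I_n}) a => #|A| <= a)%N) => //; first by rewrite cards0.
move=> A a B b Aa Bb; apply: leq_trans (leq_add Aa Bb).
by rewrite cardsU leq_subr.
Qed.

(** If [x |: U] is unsatisfiable, a minimal unsatisfiable part of it either avoids [x], so that [x]
    is not pivotal, or yields a blocking set inside [S]. If it has a solution [y], fixing its
    variables as in [y] satisfies all of [x |: U]; when [x] is pivotal, the remaining clauses then
    have solutions but none compatible with these literals. *)
Lemma restricted_pivotal_le p (delta : R) m x S U : 0 <= p <= 2^-1 -> (0 < m)%N ->
  (k * m <= n)%N ->
  (forall l : seq (literal n), size l = (k * m)%N -> uniq (map fst l) -> kills k p l <= 2^-1 * delta) ->
  (#|S| < m)%N -> (forall V, V \in blocking m x -> ~~ (V \subset S)) -> U \subset S ->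
  Ex p (fun F => diff x unsat (U :|: F :\: S)) <= 2 ^+ #|S| * delta.
Proof.
move=> /andP[p0 p2] m0 kmn small Sm noblock US.
have p01 : 0 <= p <= 1 by rewrite p0; lra.
have q2 : 2^-1 <= 1 - p by lra.
have q0 : 0 <= 1 - p by lra.
have q1 : 1 - p <= 1 by lra.
have delta0 : 0 <= delta.
  have := small [seq (i, true) | i <- take (k * m) (enum 'I_n)].
  rewrite size_map size_take -cardE card_ord -map_comp map_id.
  have -> : (if (k * m < n)%N then (k * m)%N else n) = (k * m)%N by case: ltnP => //; lia.
  move=> /(_ (erefl _) (take_uniq _ (enum_uniq _))).
  by have : 0 <= kills k p [seq (i, true) | i <- take (k * m) (enum 'I_n)]; [apply: Ex_ge0|lra].
have [s0|/set0Pn[y ys]] := eqVneq (sol (x |: U)) set0.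
  rewrite (@eq_Ex _ _ _ _ (fun=> 0)) ?Ex_cst ?mulr_ge0 ?exprn_ge0 // => F.
  rewrite diff_unsatE; case: eqP => //= Fx.
  have [W /minsetP[/eqP W0 Wmin] WU] := minset_exists (P := fun W => sol W == set0) (introT eqP s0).
  have [xW|xW] := boolP (x \in W).
    have WxU : W :\ x \subset U.
      by apply/subsetP => c; rewrite !inE => /andP[cx /(subsetP WU)]; rewrite !inE (negbTE cx).
    have : W :\ x \in blocking m x.
      rewrite inE !inE eqxx /= setD1K // (leq_ltn_trans _ Sm) ?subset_leq_card ?(subset_trans WxU) //=.
      by apply/minsetP; split => //; exact/eqP.
    by move/noblock; rewrite (subset_trans WxU US).
  have WF : W \subset (U :|: F :\: S) :\ x.
    apply/subsetP => c cW; have cx : c != x by apply: contraNneq xW => <-.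
    by have := subsetP WU c cW; rewrite !inE (negbTE cx) /= => ->.
  by case: Fx; apply: sol_sub0 WF W0.
pose V0 := \bigcup_(c in x |: U) vars c.
have V0card : (#|V0| <= k * m)%N.
  apply: leq_trans (card_all_vars _) _; rewrite mulnC leq_mul2l; apply/orP; right.
  rewrite cardsU1; apply: leq_trans (leq_add (leq_b1 _) (subset_leq_card US)) _.
  by rewrite add1n.
have [|vs [vs_uniq vs_size V0vs]] := @exists_distinct_superset n V0 (k * m).
  by rewrite V0card.
pose l := [seq (i, y i) | i <- vs].
have lfst : map fst l = vs by rewrite /l -map_comp map_id_in.
pose kap F : R := ((sol F != set0) && (cut (sol F) l == set0))%:R.
have kap0 F : 0 <= kap F by apply: ler0n.
have le1 : Ex p (fun F => diff x unsat (U :|: F :\: S)) <= Ex p (fun F => kap (F :\: (x |: S))).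
  apply: le_Ex => // F; rewrite diff_unsatE /kap ler_nat.
  case: (boolP (sol (x |: (U :|: F :\: S)) == set0)) => [/eqP Gs|]; last by rewrite andbF.
  have sub1 : F :\: (x |: S) \subset (U :|: F :\: S) :\ x.
    by apply/subsetP => c; rewrite !inE negb_or -andbA => /and3P[-> -> ->]; rewrite orbT.
  have -> : cut (sol (F :\: (x |: S))) l == set0.
    apply/eqP/setP => z; rewrite in_set0 inE; apply/negbTE/negP => /andP[zs /allP zl].
    have zy i : i \in V0 -> z i = y i.
      by move=> /V0vs iv; apply/eqP/(zl (i, y i)); apply/mapP; exists i.
    have zxU : z \in sol (x |: U).
      apply/in_solP => c cxU; have : y \notin violated c by move/in_solP: ys; apply.
      by rewrite (@eq_violated _ _ c z y) // => i ic; apply/zy/bigcupP; exists c.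
    suff : z \in sol (x |: (U :|: F :\: S)) by rewrite Gs in_set0.
    apply/in_solP => c cG; have [cxU|cxU] := boolP (c \in x |: U); first by move/in_solP: zxU; apply.
    move/in_solP: (zs); apply; move: cG cxU; rewrite !inE !negb_or.
    by case/or3P => [->//|->|/andP[-> ->]]; rewrite ?andbF //= => /andP[-> _].
  rewrite !andbT; case: eqVneq => //= nG.
  by case: eqVneq => // s0; case/eqP: nG; apply: sol_sub0 sub1 s0.
apply: le_trans le1 _.
have kl : kills k p l <= 2^-1 * delta by apply: small; rewrite ?lfst ?size_map.
have := le_trans (Ex_setD (x |: S) p01 kap0) kl.
set E := Ex p _ => hE.
have E0 : 0 <= E by apply: Ex_ge0.
(* Discarding [x |: S] costs a factor 2 per clause as [p <= 2^-1]; the one for [x] is covered by the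
   [2^-1] in the hypothesis on [kills]. *)
have pw : 2^-1 ^+ #|S|.+1 <= (1 - p) ^+ #|x |: S|.
  apply: (@le_trans _ _ ((1 - p) ^+ #|S|.+1)); first by apply: lerXn2r; rewrite ?nnegrE ?invr_ge0.
  by rewrite ler_wiXn2l // cardsU1 -add1n leq_add2r leq_b1.
have {hE} hE : 2^-1 ^+ #|S|.+1 * E <= 2^-1 * delta.
  by apply: le_trans hE; rewrite ler_wpM2r.
move: hE; rewrite exprS -mulrA ler_pM2l ?invr_gt0 // => hE.
by rewrite -ler_pdivrMl ?exprn_gt0 // -exprVn.
Qed.

(** The mean of [kill] over satisfiable [F] is at least [2^-1 ^+ m * delta]. Values below half of
    this bound contribute at most half of it; above, [amplify] makes [F] unsatisfiable with
    probability at least 1/2. *)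
Lemma unsat_increment p p1 (beta delta : R) (l : seq (literal n)) m : 0 <= p <= 1 -> 0 <= p1 <= 1 ->
  (1 < k)%N -> (0 < n)%N -> (2 * m <= n)%N -> 0 < delta ->
  size l = m -> uniq (map fst l) -> delta <= kills k p l ->
  (forall j, n%:R * (4^-1 ^+ m * (2^-1 * delta)) <= j%:R -> (1 - p1) ^+ 'C(j, k) <= beta) ->
  m%:R * k%:R ^+ m * beta <= 2^-1 ->
  Ex p unsat + 4^-1 * (2^-1 ^+ m * delta) <=
  Ex (1 - (1 - p) * (1 - union_rate p1 m)) unsat.
Proof.
move=> p01 p101 k1 n0 mn delta0 lm ul lk hbeta mkb.
(* One factor [2^-1 ^+ m] comes from [kill_spread], the other offsets the [2 ^+ m] in [amplify];
   [2 ^+ m * q] is the half-mean threshold. *)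
pose q := 4^-1 ^+ m * (2^-1 * delta).
have q0 : 0 < q by rewrite !mulr_gt0 ?exprn_gt0 ?invr_gt0.
have qE : 2 ^+ m * q = 2^-1 * (2^-1 ^+ m * delta).
  rewrite /q mulrA -exprMn.
  have -> : (2 * 4^-1 : R) = 2^-1 by field.
  by rewrite mulrCA.
have u01 := union_rate_itv m p101.
have hs : 2^-1 ^+ m * delta <= Ex p (fun F => (sol F != set0)%:R * kill R m (sol F)).
  under eq_Ex => F do rewrite -[X in kill R m X]cut_nil.
  apply: (@kill_spread R n k p delta m m [::]) => //; last exact: ltW.
  by move=> l' l'm ul'; rewrite (@kills_symmetric _ _ _ _ l' l) // l'm.
rewrite -Ex_union -lerBrDl -ExB.
(* An affine minorant of the increment: nonpositive below the threshold and at most 1/2 above it. *)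
apply: (@le_trans _ _ (Ex p (fun F => 2^-1 * ((sol F != set0)%:R * kill R m (sol F) - 2 ^+ m * q)))).
  rewrite ExZ ExB Ex_cst qE; move: hs; lra.
apply: le_Ex => // F; rewrite -(Ex_cst (nae_clause n k) (union_rate p1 m) (unsat F)) -ExB.
have diff0 G : 0 <= unsat (F :|: G) - unsat F by rewrite subr_ge0 unsat_mono ?subsetUl.
have [kF|kF] := lerP ((sol F != set0)%:R * kill R m (sol F)) (2 ^+ m * q).
  apply: (@le_trans _ _ 0); first by rewrite pmulr_rle0 ?subr_le0 ?invr_gt0.
  exact: Ex_ge0.
have F0 : sol F != set0.
  by apply: contraTneq kF => ->; rewrite eqxx mul0r -leNgt mulr_ge0 ?exprn_ge0 // ltW.
rewrite F0 mul1r in kF *.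
have amp := amplify k1 n0 q0 p101 hbeta (ltW kF).
apply: (@le_trans _ _ (1 - m%:R * k%:R ^+ m * beta)).
  have := kill_le1 R m (sol F); have : 0 <= 2 ^+ m * q by rewrite mulr_ge0 ?exprn_ge0 // ltW.
  lra.
apply: le_trans (lerB (lexx 1) amp) _.
rewrite -[X in X - _](Ex_cst (nae_clause n k) (union_rate p1 m) 1) -ExB.
apply: le_Ex => // G; rewrite /unsat (negbTE F0) subr0 solU.
by case: eqP => _; rewrite ?subr0 ?subrr.
Qed.

End Unsat.

(** * Counting minimal unsatisfiable formulas *)

Lemma ffact_le_exp a b : (a ^_ b <= a ^ b)%N.
Proof.
elim: b a => [|b IH] a; first by rewrite ffactn0.
rewrite ffactnS expnS leq_mul2l (leq_trans (IH _)) ?orbT //.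
by case: b {IH} => // b; rewrite leq_exp2r // leq_pred.
Qed.

Lemma bin_le_exp a b : ('C(a, b) <= a ^ b)%N.
Proof.
apply: leq_trans (ffact_le_exp a b).
by rewrite -bin_ffact leq_pmulr ?fact_gt0.
Qed.

Section Counting.
Variables (n k : nat).
Implicit Types (x c : nae_clause n k) (y z : assignment n) (U W : {set nae_clause n k}) (V : {set 'I_n}).

(** Otherwise flip [i] in an assignment that violates [c] alone. No other clause sees the change,
    and as [c] has a second variable, left unchanged, the result is neither forbidden pattern of
    [c]. *)
Lemma minunsat_degree W i c : (1 < k)%N -> minunsat W -> c \in W -> i \in vars c ->
  exists2 d, d \in W :\ c & i \in vars d.
Proof.
move=> k1 /minsetP[/eqP W0 Wmin] cW ic.
apply/exists_inP; apply: contraT => /exists_inPn lonely.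
have /set0Pn[y ys] : sol (W :\ c) != set0.
  apply/negP => /Wmin/(_ (subD1set _ _)) WE.
  by move: cW; rewrite -WE !inE eqxx.
have ysol : forall d, d \in W -> d != c -> y \notin violated d.
  by move=> d dW dc; move/in_solP: ys; apply; rewrite !inE dc.
have yc : y \in violated c.
  apply: contraT => yc; suff : y \in sol W by rewrite W0 in_set0.
  apply/in_solP => d dW; have [->//|dc] := eqVneq d c; exact: ysol.
pose y' : assignment n := [ffun j => y j (+) (j == i)].
suff : y' \in sol W by rewrite W0 in_set0.
apply/in_solP => d dW; have [->|dc] := eqVneq d c.
  rewrite (violatedE _ yc) /same_class negb_or; apply/andP; split; apply/forall_inPn.
    by exists i => //; rewrite ffunE eqxx; case: (y i).
  have [j] : exists j, j \in vars c :\ i.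
    by apply/set0Pn; rewrite -card_gt0; have := card_vars c; rewrite (cardsD1 i) ic; lia.
  by rewrite !inE => /andP[ji jc]; exists j => //; rewrite ffunE (negbTE ji); case: (y j).
rewrite (@eq_violated _ _ d y' y) ?ysol // => j jd; rewrite ffunE.
have : i \notin vars d by apply: lonely; rewrite !inE dc.
by case: eqVneq jd => [->->//|_]; rewrite addbF.
Qed.

Lemma minunsat_few_vars W : (1 < k)%N -> minunsat W ->
  (2 * #|\bigcup_(c in W) vars c| <= k * #|W|)%N.
Proof.
move=> k1 Wm.
have -> : (k * #|W| = \sum_(c in W) #|vars c|)%N.
  by rewrite mulnC -sum_nat_const; apply: eq_bigr => c _; rewrite card_vars.
have -> : (\sum_(c in W) #|vars c| = \sum_(i : 'I_n) #|[set c in W | i \in vars c]|)%N.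
  under eq_bigr => c _ do rewrite -sum1_card.
  rewrite (exchange_big_dep xpredT) //=; apply: eq_bigr => i _.
  by rewrite -sum1dep_card.
rewrite mulnC -sum_nat_const [leqRHS](bigID (fun i => i \in \bigcup_(c in W) vars c)) /=.
apply: leq_trans (leq_addr _ _); apply: leq_sum => i /bigcupP[c cW ic].
have [d] := minunsat_degree k1 Wm cW ic; rewrite !inE => /andP[dc dW] id.
by rewrite (cardsD1 c) !inE cW ic (cardsD1 d) !inE dc dW id.
Qed.

(** A clause is encoded by its variables in order, each with its value at a chosen violating
    assignment. *)
Lemma card_clauses_on V : (#|[set c : nae_clause n k | vars c \subset V]| <= (2 * #|V|) ^ k)%N.
Proof.
pose pt c := xchoose (violated_point c).
have ptP c : pt c \in violated c := xchooseP (violated_point c).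
pose code c : {ffun 'I_k -> literal n} :=
  [ffun j => let i := enum_val (cast_ord (esym (card_vars c)) j) in (i, pt c i)].
have code_inj : injective code.
  move=> c1 c2 e.
  have sub a b : code a = code b -> forall i, i \in vars a -> i \in vars b /\ pt a i = pt b i.
    move=> /ffunP eab i ia.
    have := eab (cast_ord (card_vars a) (enum_rank_in ia i)); rewrite !ffunE /=.
    rewrite cast_ordK enum_rankK_in //.
    set u := enum_val (cast_ord (esym (card_vars b)) _) => -[e1 e2].
    have ub : u \in vars b by exact: enum_valP.
    by split; [rewrite e1|rewrite e2 -e1].
  have vE : vars c1 = vars c2.
    apply/setP => i; apply/idP/idP => h; [exact: (sub _ _ e i h).1|exact: (sub _ _ (esym e) i h).1].
  apply: (@eq_clause _ _ c1 c2 (pt c1)) => //.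
  by rewrite (@eq_violated _ _ c2 (pt c1) (pt c2)) // => i; rewrite -vE => /(sub _ _ e)[].
rewrite -(card_imset _ code_inj).
have := card_ffun_on 'I_k (mem (setX V [set: bool])).
rewrite cardsX cardsT card_bool card_ord mulnC => <-.
apply: subset_leq_card; apply/subsetP => f /imsetP[c]; rewrite inE => cV ->.
apply/ffun_onP => j; rewrite ffunE /= !inE andbT; apply: (subsetP cV); exact: enum_valP.
Qed.

(** The variables of the formula are padded to a set of exactly [(k * w)./2], for which [k * w <= n]
    leaves room; then [w] clauses are chosen on this set. *)
Lemma card_minunsat w : (1 < k)%N -> (k * w <= n)%N ->
  (#|[set W : {set nae_clause n k} | minunsat W & #|W| == w]| <= n ^ (k * w)./2 * ((k * w) ^ k) ^ w)%N.
Proof.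
move=> k1 kwn.
have h2 : ((k * w)./2 <= n)%N by lia.
pose D := [set V : {set 'I_n} | #|V| == (k * w)./2].
apply: (@leq_trans (\sum_(V in D) #|[set W : {set nae_clause n k} |
    W \subset [set c | vars c \subset V] & #|W| == w]|)).
  apply: (@leq_trans #|\bigcup_(V in D) [set W : {set nae_clause n k} |
    W \subset [set c | vars c \subset V] & #|W| == w]|).
    apply: subset_leq_card; apply/subsetP => W; rewrite inE => /andP[Wm /eqP Ww].
    have V0 : (#|\bigcup_(c in W) vars c| <= (k * w)./2)%N.
      have := minunsat_few_vars k1 Wm; rewrite Ww; lia.
    have [|vs [vs_uniq vs_size V0vs]] :=
      @exists_distinct_superset n (\bigcup_(c in W) vars c) (k * w)./2.
      by rewrite V0.
    apply/bigcupP; exists [set i in vs].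
      by rewrite inE cardsE (card_uniqP vs_uniq) vs_size.
    rewrite inE Ww eqxx andbT; apply/subsetP => c cW; rewrite inE.
    by apply/subsetP => i ic; rewrite inE; apply: V0vs; apply/bigcupP; exists c.
  elim/big_rec2: _ => [|V a B _ Ba]; first by rewrite cards0.
  by rewrite cardsU; apply: leq_trans (leq_subr _ _) _; rewrite leq_add2l.
apply: (@leq_trans (\sum_(V in D) ((k * w) ^ k) ^ w)).
  apply: leq_sum => V; rewrite inE => /eqP Vc.
  rewrite cards_draws.
  apply: (@leq_trans (#|[set c : nae_clause n k | vars c \subset V]| ^ w)).
    exact: bin_le_exp.
  have kw2 : (2 * #|V| <= k * w)%N by rewrite Vc; lia.
  case: w {Vc D h2 kwn} kw2 => [|w] kw2; first by rewrite !expn0.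
  rewrite leq_exp2r //; apply: leq_trans (card_clauses_on V) _.
  by rewrite leq_exp2r // ltnW.
rewrite sum_nat_const leq_mul2r; apply/orP; right.
by rewrite /D card_draws card_ord bin_le_exp.
Qed.

End Counting.

(** * First-moment estimates for solutions and for blocking sets *)

Section Rates.
Variables (R : realFieldType) (n k : nat).
Implicit Types (p : R).

(** First moment: an assignment violates a clause on every [k]-set of variables, and is a solution
    only if all of these are absent. *)
Lemma sol_rate p : 0 <= p <= 1 ->
  1 - 2 ^+ n * (1 - p) ^+ 'C(n, k) <= Ex p (@unsat R n k).
Proof.
move=> /andP[p0 p1]; have p01 : 0 <= p <= 1 by rewrite p0.
rewrite lerBlDr -lerBlDl -[X in X - _](Ex_cst (nae_clause n k) p 1) -ExB.
pose A (y : assignment n) := [set c : nae_clause n k | y \in violated c].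
apply: (@le_trans _ _ (Ex p (fun F => \sum_(y : assignment n) (F :&: A y == set0)%:R))).
  apply: le_Ex => // F; rewrite /unsat; case: eqVneq => [_|/set0Pn[y ys]].
    by rewrite subrr sumr_ge0.
  rewrite subr0 (bigD1 y) //=.
  have -> : F :&: A y == set0.
    apply/eqP/setP => c; rewrite in_set0 in_setI /A in_set; apply/negbTE/negP => /andP[cF yc].
    by move/in_solP: ys => /(_ c cF); rewrite yc.
  by rewrite lerDl sumr_ge0.
rewrite Ex_sum.
have -> : (2 ^+ n * (1 - p) ^+ 'C(n, k) : R) = \sum_(y : assignment n) (1 - p) ^+ 'C(n, k).
  by rewrite sumr_const card_ffun card_bool card_ord -[RHS]mulr_natl natrX.
apply: ler_sum => y _; rewrite Ex_disjoint; apply: ler_wiXn2l.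
- by rewrite subr_ge0.
- by rewrite gerBl.
have DA : [set B : {set 'I_n} | #|B| == k] \subset [set vars c | c in A y].
  apply/subsetP => B; rewrite inE => /eqP Bk; have [c cB yc] := exists_clause y Bk.
  by apply/imsetP; exists c => //; rewrite inE.
rewrite -[in X in (X <= _)%N](card_ord n) -card_draws.
by apply: leq_trans (subset_leq_card DA) (leq_imset_card _ _).
Qed.

(** Pairs [(x, U)] are regrouped by [W = x |: U], which arises once for each of its clauses; hence
    the factor [w]. *)
Lemma blocking_sum_le p m : 0 <= p <= 1 ->
  \sum_(x : nae_clause n k) p * (1 - p) *
     \sum_(U in blocking m x) (4 * (p * (1 - p))) ^+ #|U| <=
  \sum_(w < m.+1) #|[set W : {set nae_clause n k} | minunsat W & #|W| == w]|%:R *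
     (w%:R * (4 * p) ^+ w).
Proof.
move=> /andP[p0 p1].
have q0 : 0 <= 1 - p by rewrite subr_ge0.
have v4 : p * (1 - p) <= p by rewrite -[leRHS]mulr1 ler_wpM2l // gerBl.
have v0 : 0 <= p * (1 - p) by rewrite mulr_ge0.
apply: (@le_trans _ _ (\sum_(x : nae_clause n k) \sum_(W : {set nae_clause n k})
    (if [&& x \in W, minunsat W & (#|W| <= m)%N] then (4 * p) ^+ #|W| else 0))).
  apply: ler_sum => x _; rewrite mulr_sumr big_mkcond /= [leRHS](sum_split_at x).
  rewrite [leLHS](sum_split_at x); apply: ler_sum => U xU.
  rewrite !inE eqxx (negbTE xU) /= addr0 add0r cardsU1 xU add1n andbC.
  case: ifP => // _; rewrite exprS; apply: ler_pM => //.
  - by rewrite exprn_ge0 // mulr_ge0.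
  - by move: p0 v4; lra.
  - by apply: lerXn2r; rewrite ?nnegrE ?mulr_ge0 // ler_wpM2l.
rewrite exchange_big /=.
rewrite (eq_bigr (fun W : {set nae_clause n k} => if minunsat W && (#|W| <= m)%N then
   #|W|%:R * (4 * p) ^+ #|W| else 0)); last first.
  move=> W _; case: (minunsat W && (#|W| <= m)%N); last first.
    by apply: big1 => x _; rewrite andbF.
  under eq_bigr => x _ do rewrite andbT.
  by rewrite -big_mkcond sumr_const -[LHS]mulr_natl.
rewrite -big_mkcond (partition_big (fun W : {set nae_clause n k} => inord #|W| : 'I_m.+1) xpredT) //=.
apply: ler_sum => w _.
rewrite (eq_bigr (fun=> w%:R * (4 * p) ^+ w)) => [|W /andP[/andP[_ Wm] /eqP <-]]; last first.
  by rewrite inordK.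
rewrite sumr_const -[leLHS]mulr_natl ler_wpM2r ?mulr_ge0 ?exprn_ge0 ?mulr_ge0 //.
rewrite ler_nat; apply: subset_leq_card; apply/subsetP => W; rewrite inE unfold_in.
by move=> /andP[/andP[-> Wm] /eqP <-]; rewrite inordK ?eqxx.
Qed.

End Rates.

(** * The critical window *)

(* Here [m] bounds the size of the restrictions, [M] the number of variables they
   involve and [2 ^- m] the probability they may produce; the truncation level in
   [variance_le_influence] is [32 ^- d].  A flat point of the window, where the
   derivative is [O(d)] and the increment over [Delta] is [O(1 / J)], contradicts
   either the variance bound or [unsat_increment]. *)
Lemma window_core (R : rcfType) (n k d : nat) (eta p0 P0 P1 p1 : R) :
  let m := (20 * d)%N in let M := (k * m)%N in let J := (16 * 2 ^ (M + m)).+1 in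
  (1 < k)%N -> (0 < n)%N -> (0 < d)%N -> 0 < eta -> eta < 1 / 2 ->
  0 <= P0 -> P1 <= p0 -> p0 <= 2^-1 ->
  (forall p, P0 < p -> p < P1 -> eta <= Ex p (@unsat R n k) <= 1 - eta) ->
  (2 * M <= n)%N ->
  (forall p, 0 <= p -> p <= p0 -> 2 ^+ (18 * d) *
     (\sum_(w < m.+1) #|[set W : {set nae_clause n k} | minunsat W & #|W| == w]|%:R *
     (w%:R * (4 * p) ^+ w)) <= eta / 8) ->
  0 <= p1 <= 1 ->
  (forall j, (n%:R : R) * (4^-1 ^+ M * (2^-1 * (2^-1 * 2^-1 ^+ m))) <= j%:R ->
     (1 - p1) ^+ 'C(j, k) <= (2 * (M%:R * k%:R ^+ M))^-1) ->
  M%:R * p1 * (J%:R + 1) <= P1 - P0 ->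
  P1 - P0 <= 32 / eta * p0 / d%:R.
Proof.
move=> m M J k1 n0 d0 eta0 eta2 P00 P1p0 p0h crit Mn blk p101 hp1 hM.
rewrite leNgt; apply/negP => hW.
have J0 : 0 < J%:R :> R by rewrite ltr0n.
have d0' : 0 < d%:R :> R by rewrite ltr0n.
have J10 : 0 < J%:R + 1 :> R by rewrite addr_gt0.
have M0 : (0 < M)%N by rewrite !muln_gt0 d0 ltnW.
have p00 : 0 <= p0.
  have [//|p0n] := lerP 0 p0; have := le_lt_trans P1p0 p0n; move: hM.
  have : 0 <= M%:R * p1 * (J%:R + 1).
    by rewrite mulr_ge0 ?(ltW J10) // mulr_ge0 //; case/andP: p101.
  move: P00; lra.
have W0 : 0 < P1 - P0.
  by apply: le_lt_trans hW; rewrite !mulr_ge0 ?invr_ge0 // ltW.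
pose Delta := (P1 - P0) / (J%:R + 1).
have D0 : 0 < Delta by rewrite divr_gt0.
have P11 : P1 <= 1 by move: P1p0 p0h; lra.
have f01 (F : {set nae_clause n k}) : 0 <= unsat R F <= 1 by rewrite ler0n lern1 leq_b1.
have Ex01 p : 0 <= p <= 1 -> 0 <= Ex p (@unsat R n k) <= 1.
  move=> p01; apply/andP; split; first by apply: Ex_ge0 => // F; case/andP: (f01 F).
  by rewrite -[leRHS](Ex_cst (nae_clause n k) p 1); apply: le_Ex => // F; case/andP: (f01 F).
have JD : (J%:R + 1) * Delta <= P1 - P0 by rewrite mulrC divfK // lt0r_neq0.
have [p [P0p pP1 flat jump]] : exists p, [/\ P0 < p, p + Delta <= P1,
    (Ex_poly (@unsat R n k))^`().[p] <= 2 / J%:R / Delta &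
    (Ex_poly (@unsat R n k)).[p + Delta] - (Ex_poly (@unsat R n k)).[p] <= 2 / J%:R].
  apply: (@exists_flat_point _ _ P0 P1 Delta J) => //.
    move=> x y xP xy yP; rewrite !horner_Ex_poly; apply: Ex_mono => //.
    - by move=> F G; apply: unsat_mono.
    - exact: le_trans xP.
    - exact: le_trans P11.
  move=> x /andP[xP Px]; rewrite horner_Ex_poly; apply: Ex01.
  by rewrite (le_trans P00 xP) (le_trans Px P11).
have pP1' : p < P1 by apply: lt_le_trans pP1; rewrite ltrDl.
have pp0 : p <= p0 by apply: le_trans P1p0; apply: ltW.
have p0' : 0 < p by apply: le_lt_trans P0p.
have p01 : 0 < p < 1 by rewrite p0' (lt_le_trans pP1').
have p01w : 0 <= p <= 1 by case/andP: p01 => *; rewrite !ltW.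
have ph : 0 <= p <= 2^-1 by rewrite (ltW p0') (le_trans pp0).
have /andP[critl critr] := crit p P0p pP1'.
rewrite !horner_Ex_poly in jump.
pose delta : R := 2^-1 ^+ m.
have delta0 : 0 < delta by rewrite exprn_gt0 // invr_gt0.
pose K : R := eta / 8 * d%:R.
(* The slope is at most [4 / (P1 - P0)], and the window is assumed wider than [32 / eta * p0 / d],
   whence [K]. *)
have flatK : p * (1 - p) * (2 / J%:R / Delta) <= K.
  have hD : 2 / J%:R / Delta <= 4 / (P1 - P0).
    have -> : 2 / J%:R / Delta = 2 * (J%:R + 1) / (J%:R * (P1 - P0)).
      by rewrite /Delta; field; rewrite !lt0r_neq0.
    rewrite ler_pdivrMr ?mulr_gt0 //.
    have -> : 4 / (P1 - P0) * (J%:R * (P1 - P0)) = 4 * J%:R by field; rewrite lt0r_neq0.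
    have : 1 <= J%:R :> R by rewrite ler1n.
    by clear; lra.
  have vp0 : p * (1 - p) <= p0.
    apply: le_trans pp0; rewrite -[leRHS]mulr1 ler_wpM2l ?(ltW p0') //; move: p0'; lra.
  apply: (@le_trans _ _ (p0 * (4 / (P1 - P0)))).
    apply: ler_pM => //; first by rewrite mulr_ge0 ?(ltW p0') // subr_ge0; case/andP: p01w.
    by rewrite !mulr_ge0 ?invr_ge0 // ltW.
  rewrite mulrA ler_pdivrMr //.
  have := ltW hW; rewrite ler_pdivrMr // => hW'.
  have -> : K * (P1 - P0) = eta / 8 * ((P1 - P0) * d%:R) by rewrite /K; ring.
  apply: le_trans (ler_wpM2l _ hW'); last by rewrite divr_ge0 // ltW.
  by rewrite le_eqVlt; apply/orP; left; apply/eqP; field; rewrite lt0r_neq0.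
pose l0 : seq (literal n) := [seq (i, true) | i <- take M (enum 'I_n)].
have l0fst : map fst l0 = take M (enum 'I_n) by rewrite -map_comp map_id.
have l0size : size l0 = M.
  by rewrite size_map size_takel // -cardE card_ord; apply: leq_trans Mn; rewrite leq_pmull.
have l0uniq : uniq (map fst l0) by rewrite l0fst take_uniq // enum_uniq.
have [small|big] := lerP (kills k p l0) (2^-1 * delta).
  have var := @variance_le_influence R _ p p01 (@unsat R n k) (blocking m) d m
    (32^-1 ^+ d) delta K
    (\sum_(w < m.+1) #|[set W : {set nae_clause n k} | minunsat W & #|W| == w]|%:R *
     (w%:R * (4 * p) ^+ w)) d0.
  have : Ex p (fun F : {set nae_clause n k} => unsat R F ^+ 2) - Ex p (@unsat R n k) ^+ 2 <= 3 / 8 * eta.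
    apply: le_trans (var _ _ _ _ _ _) _.
    - by rewrite exprn_gt0 // invr_gt0.
    - exact: lexx.
    - by move=> x F; apply: diff_unsat_itv.
    - move=> x S Sm nb U US; apply: (@restricted_pivotal_le R n k p delta m x S U) => //.
      + by rewrite muln_gt0.
      + by apply: leq_trans Mn; rewrite leq_pmull.
      + by move=> l lM lu; rewrite (kills_symmetric k p _ lu l0uniq) // lM l0size.
    - apply: le_trans flatK; rewrite -mulr_sumr -russo ler_wpM2l //.
      by rewrite mulr_ge0 ?(ltW p0') // subr_ge0; case/andP: p01w.
    - exact: blocking_sum_le.
    set B := \sum_(w < m.+1) _; have := blk p (ltW p0') pp0; rewrite -/B => hB.
    (* The choice [lam = 32^-1 ^+ d] makes the first factor [4^-1 ^+ d] and the second
       [2 ^+ (18 * d)]; then [delta = 2^-1 ^+ (20 * d)] brings the latter to [4^-1 ^+ d] too, which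
       explains [m = 20 * d]. *)
    have e1 : 8 ^+ d * 32^-1 ^+ d = 4^-1 ^+ d :> R.
      by rewrite -exprMn; congr (_ ^+ d); field.
    have e2 : 8 ^+ d * (32^-1 ^+ d) ^- 3 = 2 ^+ (18 * d) :> R.
      rewrite !exprVn invrK -exprM [(d * 3)%N]mulnC [in LHS]exprM -exprMn [RHS]exprM.
      by congr (_ ^+ d); ring.
    have e3 : 2 ^+ (18 * d) * delta = 4^-1 ^+ d.
      by rewrite /delta /m !exprM -exprMn; congr (_ ^+ d); field.
    have -> : 8 ^+ d * (32^-1 ^+ d * K + (32^-1 ^+ d) ^- 3 * (delta * K + B)) + d%:R^-1 * K =
      8 ^+ d * 32^-1 ^+ d * K + (8 ^+ d * (32^-1 ^+ d) ^- 3) * delta * K +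
      8 ^+ d * (32^-1 ^+ d) ^- 3 * B + d%:R^-1 * K by ring.
    rewrite e1 e2 e3.
    have h4 : 2 * (4^-1 ^+ d * K) <= eta / 8.
      have -> : 2 * (4^-1 ^+ d * K) = eta / 8 * (4^-1 ^+ d * (2 * d%:R)) by rewrite /K; ring.
      rewrite -[leRHS]mulr1 ler_wpM2l ?divr_ge0 ?(ltW eta0) // exprVn mulrC.
      rewrite ler_pdivrMr ?exprn_gt0 // mul1r -natrX -natrM ler_nat.
      have -> : (4 ^ d = 2 ^ d * 2 ^ d)%N by rewrite -expnMn.
      by apply: leq_mul; [case: (d) d0 => // e _; rewrite expnS leq_pmulr ?expn_gt0|apply/ltnW/ltn_expl].
    have hKd : d%:R^-1 * K = eta / 8 by rewrite /K mulrCA mulVf ?mulr1 // lt0r_neq0.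
    rewrite hKd; move: h4 hB; set a := _ * K; set b := _ * B; clear; lra.
  (* The variance is [mu * (1 - mu) >= eta * (1 - eta) > eta / 2], against the bound of
     [3 / 8 * eta]. *)
  have -> : Ex p (fun F : {set nae_clause n k} => unsat R F ^+ 2) = Ex p (@unsat R n k).
    by apply: eq_Ex => F; rewrite /unsat; case: (_ == _); rewrite ?expr1n ?expr0n.
  move: critl critr eta0 eta2; set mu := Ex p _; nra.
have hbeta : M%:R * k%:R ^+ M * (2 * (M%:R * k%:R ^+ M))^-1 <= 2^-1 :> R.
  rewrite invfM mulrCA divff ?mulr1 // mulf_neq0 ?pnatr_eq0 ?expf_neq0 ?pnatr_eq0 -?lt0n //.
  exact: ltnW.
have := @unsat_increment R n k p p1 (2 * (M%:R * k%:R ^+ M))^-1 (2^-1 * delta) l0 M p01w p101 k1 n0 Mn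
  (mulr_gt0 _ delta0) l0size l0uniq (ltW big).
rewrite invr_gt0 ltr0n => /(_ isT hp1 hbeta) inc.
have up : 1 - (1 - p) * (1 - union_rate p1 M) <= p + Delta.
  have := union_rate_le M p101; have /andP[u0 u1] := union_rate_itv M p101.
  have : M%:R * p1 <= Delta by rewrite ler_pdivlMr.
  have : 0 <= p * union_rate p1 M by rewrite mulr_ge0 // ltW.
  lra.
have inc2 : Ex (1 - (1 - p) * (1 - union_rate p1 M)) (@unsat R n k) <= Ex (p + Delta) (@unsat R n k).
  apply: Ex_mono => //; first by move=> F G; apply: unsat_mono.
    have /andP[u0 u1] := union_rate_itv M p101; case/andP: p01w => *; nra.
  exact: le_trans P11.
(* The added clauses gain [8^-1 * 2^-1 ^+ (M + m)]; [J] is just above [16 * 2 ^ (M + m)], so that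
   [2 / J] is strictly smaller. *)
have : 4^-1 * (2^-1 ^+ M * (2^-1 * delta)) <= 2 / J%:R.
  have := le_trans inc inc2; rewrite -lerBrDl => /le_trans; apply.
  by move: jump; lra.
apply/negP; rewrite -ltNge ltr_pdivrMr // /delta.
have -> : 4^-1 * (2^-1 ^+ M * (2^-1 * 2^-1 ^+ m)) = 8^-1 * 2^-1 ^+ (M + m) :> R.
  by rewrite exprD; field.
have -> : J%:R = 16 * 2 ^+ (M + m) + 1 :> R by rewrite /J -[LHS]natr1 natrM natrX.
rewrite mulrDr mulr1.
have -> : 8^-1 * 2^-1 ^+ (M + m) * (16 * 2 ^+ (M + m)) = 2 :> R.
  by rewrite exprVn; field; rewrite expf_neq0 // pnatr_eq0.
by rewrite ltrDl mulr_gt0 ?exprn_gt0 ?invr_gt0.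
Qed.

(** * Size requirements on [n], all exponentially bounded in [d] *)

Definition exp_bounded (h : nat -> nat) :=
  exists A : nat, forall d, (0 < d)%N -> (h d <= A ^ d)%N.

Lemma exp_bounded_cst c : exp_bounded (fun=> c).
Proof. by exists c => -[//|d] _; case: c => // c; rewrite expnS leq_pmulr ?expn_gt0. Qed.

Lemma exp_bounded_id : exp_bounded id.
Proof. by exists 2%N => d _; apply/ltnW/ltn_expl. Qed.

Lemma exp_bounded_mul g h : exp_bounded g -> exp_bounded h ->
  exp_bounded (fun d => g d * h d)%N.
Proof.
by move=> [A gA] [B hB]; exists (A * B)%N => d d0; rewrite expnMn leq_mul ?gA ?hB.
Qed.

Lemma exp_bounded_pow h c : exp_bounded h -> exp_bounded (fun d => h d ^ c)%N.
Proof.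
move=> [A hA]; exists (A ^ c)%N => d d0; rewrite -expnM mulnC expnM.
by case: c => // c; rewrite leq_exp2r // hA.
Qed.

Lemma exp_bounded_exp a b : exp_bounded (fun d => a ^ (b * d))%N.
Proof. by exists (a ^ b)%N => d _; rewrite expnM. Qed.

Lemma exp_bounded_le g h : (forall d, (0 < d)%N -> g d <= h d)%N ->
  exp_bounded h -> exp_bounded g.
Proof. by move=> gh [A hA]; exists A => d d0; apply: leq_trans (gh d d0) (hA d d0). Qed.

Section SizeRequirements.
Variable k : nat.

Let m d := (20 * d)%N.
Let M d := (k * m d)%N.

(** Chosen so that [4 * p0 * n ^ k <= clause_cst * n] for [p0 = 2 n / 'C(n, k)], by way of
    ['C(n, k) >= (n / 2) ^ k / k!]. *)
Definition clause_cst := (2 ^ (k + 3) * k`!)%N.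
(** What three estimates ask of [n]: at least [2 k] good variables ([size_req]), added clauses that
    fit into the window ([amplify_req]), and a blocking sum below [eta / 8] when [E >= 1 / eta]
    ([blocking_req]). *)
Definition size_req d := (8 * k * 4 ^ M d * 2 ^ m d)%N.
Definition amplify_req d :=
  (M d ^ 2 * k ^ M d * (8 * 4 ^ M d * 2 ^ m d) ^ k * (18 * 2 ^ (M d + m d)) * d)%N.
Definition blocking_req E d :=
  ((8 * E * 2 ^ (18 * d) * m d ^ 2 * (k * m d) ^ k * clause_cst) ^ 2)%N.

Lemma parameters_exist E : exists2 Q : nat, (1 < Q)%N &
  forall d n, (0 < d)%N -> (Q ^ d <= n)%N ->
   [/\ (2 * M d <= n)%N, (size_req d <= n)%N, (amplify_req d <= n)%N,
       (blocking_req E d <= n)%N & (clause_cst + E <= n)%N].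
Proof.
have eM : exp_bounded (fun d => M d).
  by apply: exp_bounded_mul (exp_bounded_cst _) (exp_bounded_mul (exp_bounded_cst _) exp_bounded_id).
have em : exp_bounded (fun d => m d) by apply: exp_bounded_mul (exp_bounded_cst _) exp_bounded_id.
have eaM a : exp_bounded (fun d => a ^ M d)%N.
  by rewrite /M /m; have [A hA] := exp_bounded_exp a (k * 20); exists A => d; rewrite mulnA; apply: hA.
have eam a : exp_bounded (fun d => a ^ m d)%N by apply: exp_bounded_exp.
have [A1 h1] : exp_bounded (fun d => 2 * M d)%N by apply: exp_bounded_mul (exp_bounded_cst _) eM.
have [A2 h2] : exp_bounded size_req.
  by rewrite /size_req; do 3?apply: exp_bounded_mul => //; apply: exp_bounded_cst.
have [A3 h3] : exp_bounded amplify_req.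
  rewrite /amplify_req; apply: exp_bounded_mul exp_bounded_id.
  apply: exp_bounded_mul; last first.
    apply: exp_bounded_mul (exp_bounded_cst _) _.
    apply: (@exp_bounded_le _ (fun d => 2 ^ M d * 2 ^ m d)%N) => [d _|]; first by rewrite expnD.
    exact: exp_bounded_mul.
  apply: exp_bounded_mul; first by apply: exp_bounded_mul => //; apply: exp_bounded_pow.
  apply: exp_bounded_pow; do 2?apply: exp_bounded_mul => //; exact: exp_bounded_cst.
have [A4 h4] : exp_bounded (blocking_req E).
  rewrite /blocking_req; apply: exp_bounded_pow.
  apply: exp_bounded_mul; last exact: exp_bounded_cst.
  apply: exp_bounded_mul; last by apply: exp_bounded_pow.
  apply: exp_bounded_mul; last by apply: exp_bounded_pow.
  apply: exp_bounded_mul; first exact: exp_bounded_cst.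
  exact: exp_bounded_exp.
have [A5 h5] : exp_bounded (fun=> clause_cst + E)%N by apply: exp_bounded_cst.
exists (2 + A1 + A2 + A3 + A4 + A5)%N; first by lia.
move=> d n d0 Qn.
have aux A : (A <= 2 + A1 + A2 + A3 + A4 + A5)%N -> (A ^ d <= n)%N.
  by move=> hA; apply: leq_trans Qn; rewrite leq_exp2r.
split.
- by apply: leq_trans (h1 d d0) (aux _ _); lia.
- by apply: leq_trans (h2 d d0) (aux _ _); lia.
- by apply: leq_trans (h3 d d0) (aux _ _); lia.
- by apply: leq_trans (h4 d d0) (aux _ _); lia.
- by apply: leq_trans (h5 d d0) (aux _ _); lia.
Qed.

End SizeRequirements.

Section Binomial.
Variable R : realFieldType.

Lemma bin_ge_real (a : R) j k : 0 <= a -> 2 * a <= j%:R -> 2 * k%:R <= (j%:R : R) ->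
  a ^+ k <= k`!%:R * 'C(j, k)%:R.
Proof.
move=> a0 aj kj; have kj' : (2 * k <= j)%N by move: kj; rewrite -natrM ler_nat.
rewrite -natrM mulnC bin_ffact.
apply: (@le_trans _ _ ((j - k)%:R ^+ k)).
  apply: lerXn2r; rewrite ?nnegrE ?ler0n // natrB; last by lia.
  move: aj kj; lra.
rewrite -natrX ler_nat.
have gen i : (i <= k)%N -> ((j - k) ^ i <= j ^_ i)%N.
  elim: i => // i IH ik; rewrite ffactnSr expnSr leq_mul ?IH ?(ltnW ik) //; lia.
exact: gen.
Qed.

(** Bernoulli's inequality for [1 + q], combined with [(1 - q) * (1 + q) <= 1]. *)
Lemma power_le_inv (q : R) c : 0 <= q <= 1 -> (1 - q) ^+ c * (1 + c%:R * q) <= 1.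
Proof.
move=> /andP[q0 q1].
have bern : 1 + c%:R * q <= (1 + q) ^+ c.
  elim: c => [|c IH]; first by rewrite mul0r addr0.
  rewrite exprS -natr1; apply: (@le_trans _ _ ((1 + q) * (1 + c%:R * q))).
    have : 0 <= c%:R * q * q by rewrite !mulr_ge0.
    lra.
  by rewrite ler_wpM2l // addr_ge0.
apply: (@le_trans _ _ ((1 - q) ^+ c * (1 + q) ^+ c)).
  by rewrite ler_wpM2l ?exprn_ge0 ?subr_ge0.
by rewrite -exprMn exprn_ile1 //; nra.
Qed.

End Binomial.

Lemma half_double_le a : (2 * a./2 <= a)%N.
Proof. by rewrite mul2n -[leqRHS]odd_double_half leq_addl. Qed.

Section Bounds.
Variables (R : rcfType) (n k : nat).

Lemma first_moment_rate_le : (0 < k)%N -> (2 * k <= n)%N ->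
  4 * (2 * n%:R / 'C(n, k)%:R) * n%:R ^+ k <= (clause_cst k)%:R * n%:R :> R.
Proof.
move=> k0 kn.
have C0 : 0 < 'C(n, k)%:R :> R by rewrite ltr0n bin_gt0; lia.
have := @bin_ge_real R (n%:R / 2) n k _ _ _.
move=> /(_ (divr_ge0 (ler0n _ _) (ler0n _ _))) h.
have {}h : (n%:R / 2 : R) ^+ k <= k`!%:R * 'C(n, k)%:R.
  by apply: h; [rewrite mulrC divfK ?pnatr_eq0|rewrite -natrM ler_nat].
have -> : 4 * (2 * n%:R / 'C(n, k)%:R) * n%:R ^+ k = 8 * n%:R * n%:R ^+ k / 'C(n, k)%:R :> R.
  by field; rewrite lt0r_neq0.
rewrite ler_pdivrMr // /clause_cst natrM natrX exprD.
have -> : 8 * n%:R * n%:R ^+ k = 2 ^+ k * 8 * n%:R * (n%:R / 2) ^+ k :> R.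
  by rewrite exprMn exprVn; field; rewrite expf_neq0 ?pnatr_eq0.
have -> : 2 ^+ k * 2 ^+ 3 * k`!%:R * n%:R * 'C(n, k)%:R =
  2 ^+ k * 8 * n%:R * (k`!%:R * 'C(n, k)%:R) :> R by ring.
by rewrite ler_wpM2l // !mulr_ge0 ?exprn_ge0.
Qed.

Lemma first_moment_rate_half : (2 < k)%N -> (0 < n)%N -> (2 * k <= n)%N ->
  (clause_cst k <= n)%N -> 2 * n%:R / 'C(n, k)%:R <= 2^-1 :> R.
Proof.
move=> k2 n0 kn cn.
have n0' : 0 < n%:R :> R by rewrite ltr0n.
have n1 : 1 <= n%:R :> R by rewrite ler1n.
have fp0 : 0 <= 4 * (2 * n%:R / 'C(n, k)%:R) :> R by rewrite mulr_ge0 // divr_ge0 // mulr_ge0.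
have hp0 := first_moment_rate_le (ltnW (ltnW k2)) kn.
set p0 : R := 2 * n%:R / 'C(n, k)%:R in fp0 hp0 *.
clearbody p0.
have cn' : (clause_cst k)%:R <= n%:R :> R by rewrite ler_nat.
have h3 : 4 * p0 * n%:R ^+ 3 <= (clause_cst k)%:R * n%:R.
  by apply: le_trans hp0; rewrite ler_wpM2l // ler_weXn2l.
have h1 : 4 * p0 * n%:R ^+ 2 <= 1 * n%:R ^+ 2.
  rewrite -(ler_pM2r n0').
  have -> : 4 * p0 * n%:R ^+ 2 * n%:R = 4 * p0 * n%:R ^+ 3 by ring.
  have -> : 1 * n%:R ^+ 2 * n%:R = (n%:R * n%:R) * n%:R :> R by ring.
  apply: le_trans h3 _; rewrite ler_wpM2r // -[leLHS]mulr1 ler_pM //.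
move: h1; rewrite ler_pM2r ?exprn_gt0 //; clear; lra.
Qed.

(** With [s = sqrt n], the count of formulas contributes [s ^ k] per clause, while [4 * p] is at
    most a constant times [s ^ (2 - 2 k)]. As [k >= 3], each clause costs at most [Y / s], and
    already the term [w = 1] is small enough. *)
Lemma blocking_small m E (X p p0 : R) : (2 < k)%N -> (0 < n)%N -> (k * m <= n)%N ->
  0 <= p -> p <= p0 -> 4 * p0 * n%:R ^+ k <= (clause_cst k)%:R * n%:R ->
  0 <= X -> 1 <= E -> 1 <= X ->
  (8 * E * X * m%:R ^+ 2 * (k%:R * m%:R) ^+ k * (clause_cst k)%:R) ^+ 2 <= n%:R ->
  X * (\sum_(w < m.+1) #|[set W : {set nae_clause n k} | minunsat W & #|W| == w]|%:R *
     (w%:R * (4 * p) ^+ w)) <= (8 * E)^-1.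
Proof.
move=> k2 n0 kmn p00 pp0 hp0 X0 E1 X1 hn.
pose s : R := Num.sqrt n%:R.
have n1 : 1 <= n%:R :> R by rewrite ler1n.
have s2 : s ^+ 2 = n%:R by rewrite sqr_sqrtr // ler0n.
have s1 : 1 <= s by rewrite -[leLHS]sqrtr1 ler_sqrt.
have s0 : 0 < s by apply: lt_le_trans s1.
pose c : R := (clause_cst k)%:R.
pose Y : R := (k%:R * m%:R) ^+ k * c.
have Y0 : 0 <= Y by rewrite mulr_ge0 ?exprn_ge0 ?mulr_ge0.
have E0 : 0 <= E by apply: le_trans E1.
have hs : 8 * E * X * m%:R ^+ 2 * Y <= s.
  have Z0 : 0 <= 8 * E * X * m%:R ^+ 2 * Y.
    by apply: mulr_ge0 => //; apply: mulr_ge0; rewrite ?exprn_ge0 // !mulr_ge0.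
  rewrite -ler_sqr ?nnegrE ?(ltW s0) // s2.
  by rewrite /Y mulrA.
have n0' : 0 < n%:R :> R by rewrite ltr0n.
have base : 4 * p * (s ^+ k) * s <= c.
  have h1 : 4 * p * n%:R ^+ k <= c * n%:R.
    by apply: le_trans hp0; rewrite ler_wpM2r ?exprn_ge0 // ler_wpM2l.
  rewrite -s2 -exprM mulnC exprM in h1.
  have sk : s ^+ 3 <= s ^+ k by rewrite ler_weXn2l.
  rewrite -(ler_pM2r (exprn_gt0 2 s0)); apply: le_trans h1.
  rewrite expr2 -[_ * s * (s * s)]mulrA -!mulrA ler_wpM2l // ler_wpM2l //.
  have -> : s * (s * s) = s ^+ 3 by rewrite !exprS expr0 mulr1.
  by rewrite [s ^+ k ^+ 2]expr2 ler_wpM2l // exprn_ge0 // ltW.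
have term (w : nat) : (w <= m)%N ->
   #|[set W : {set nae_clause n k} | minunsat W & #|W| == w]|%:R * (w%:R * (4 * p) ^+ w)
   <= m%:R * (Y / s).
  case: w => [|w] wm; first by rewrite mul0r mulr0 mulr_ge0 // divr_ge0 // ltW.
  have m1 : 1 <= m%:R :> R by rewrite ler1n (leq_trans _ wm).
  have Ys : Y / s <= 1.
    rewrite ler_pdivrMr // mul1r; apply: le_trans hs.
    rewrite -[leLHS]mul1r ler_wpM2r //.
    have : 1 <= m%:R ^+ 2 :> R by rewrite exprn_ege1.
    have : 1 <= 8 * E by move: E1; clear; lra.
    move=> h1 h2; rewrite -[leLHS]mulr1 ler_pM // -[leLHS]mulr1 ler_pM //.
  apply: (@le_trans _ _ (m%:R * (Y / s) ^+ w.+1)); last first.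
    rewrite ler_wpM2l // exprS -[leRHS]mulr1 ler_wpM2l ?divr_ge0 ?(ltW s0) //.
    by rewrite exprn_ile1 // divr_ge0 // ltW.
  rewrite mulrCA; apply: ler_pM; rewrite ?mulr_ge0 ?exprn_ge0 ?mulr_ge0 ?ler_nat //.
  have cm := @card_minunsat n k w.+1 (ltnW k2) _.
  have {cm} cm : (#|[set W : {set nae_clause n k} | minunsat W & #|W| == w.+1]|%:R : R) <=
     s ^+ (k * w.+1) * ((k%:R * m%:R) ^+ k) ^+ w.+1.
    apply: (@le_trans _ _ (n ^ (k * w.+1)./2 * ((k * w.+1) ^ k) ^ w.+1)%:R).
      by rewrite ler_nat cm //; apply: leq_trans kmn; rewrite leq_mul2l wm orbT.
    rewrite natrM; apply: ler_pM => //.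
      by rewrite natrX -s2 -exprM ler_weXn2l // half_double_le.
    rewrite natrX; apply: lerXn2r; rewrite ?nnegrE ?exprn_ge0 ?mulr_ge0 //.
    rewrite natrX; apply: lerXn2r; rewrite ?nnegrE ?mulr_ge0 //.
    by rewrite natrM ler_wpM2l // ler_nat.
  apply: le_trans (ler_wpM2r _ cm) _; first by rewrite exprn_ge0 // mulr_ge0.
  have -> : s ^+ (k * w.+1) * ((k%:R * m%:R) ^+ k) ^+ w.+1 * (4 * p) ^+ w.+1 =
      (s ^+ k * (k%:R * m%:R) ^+ k * (4 * p)) ^+ w.+1.
    by rewrite exprM [RHS]exprMn; congr (_ * _); rewrite [RHS]exprMn.
  apply: lerXn2r; rewrite ?nnegrE.
  - by apply: mulr_ge0; [apply: mulr_ge0; apply: exprn_ge0; rewrite ?mulr_ge0 ?(ltW s0)|apply: mulr_ge0].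
  - by rewrite divr_ge0 // ltW.
  rewrite ler_pdivlMr // /Y.
  have -> : s ^+ k * (k%:R * m%:R) ^+ k * (4 * p) * s =
     (k%:R * m%:R) ^+ k * (4 * p * s ^+ k * s) by ring.
  by rewrite ler_wpM2l // exprn_ge0 // mulr_ge0.
have m0 : (m = 0)%N \/ (0 < m)%N by case: (m); [left|right].
apply: (@le_trans _ _ (X * (m%:R * (m%:R * (Y / s))))).
  rewrite ler_wpM2l // big_ord_recl /= mul0r mulr0 add0r.
  apply: (@le_trans _ _ (\sum_(w < m) m%:R * (Y / s))).
    by apply: ler_sum => w _; apply: term.
  by rewrite sumr_const card_ord -[leLHS]mulr_natl.
have E0' : 0 < E by apply: lt_le_trans E1.
have -> : X * (m%:R * (m%:R * (Y / s))) = 8 * E * X * m%:R ^+ 2 * Y / (8 * E * s).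
  by field; rewrite !lt0r_neq0.
rewrite ler_pdivrMr ?mulr_gt0 //.
by rewrite [leRHS]mulrA mulVf ?mul1r // lt0r_neq0 ?mulr_gt0.
Qed.

Lemma window_bound d (E : nat) (eta P0 P1 : R) :
  let m := (20 * d)%N in let M := (k * m)%N in
  (2 < k)%N -> (0 < d)%N -> 0 < eta -> eta < 1 / 2 -> 1 <= E%:R * eta ->
  (2 * M <= n)%N -> (size_req k d <= n)%N -> (amplify_req k d <= n)%N ->
  (blocking_req k E d <= n)%N -> (clause_cst k + E <= n)%N ->
  0 <= P0 -> P1 <= 2 * n%:R / 'C(n, k)%:R ->
  (forall p, P0 < p -> p < P1 -> eta <= Ex p (@unsat R n k) <= 1 - eta) ->
  P1 - P0 <= 32 / eta * (2 * n%:R / 'C(n, k)%:R) / d%:R.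
Proof.
move=> m M k2 d0 eta0 eta2 Eeta Mn szn ampn blkn cEn P00 P1p0 crit.
have n0 : (0 < n)%N.
  by apply: leq_trans Mn; rewrite !muln_gt0 d0 /= (leq_trans _ k2).
have kn : (2 * k <= n)%N.
  by apply: leq_trans Mn; rewrite leq_mul2l /= leq_pmulr // muln_gt0.
have n0' : 0 < n%:R :> R by rewrite ltr0n.
have d0' : 0 < d%:R :> R by rewrite ltr0n.
set p0 : R := 2 * n%:R / 'C(n, k)%:R in P1p0 *.
have C0 : 0 < 'C(n, k)%:R :> R by rewrite ltr0n bin_gt0; lia.
have p00 : 0 < p0 by rewrite divr_gt0 // mulr_gt0.
have hp0 := first_moment_rate_le (ltnW (ltnW k2)) kn.
rewrite -/p0 in hp0.
have p0lb : 2 * n%:R * k`!%:R <= p0 * n%:R ^+ k.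
  rewrite /p0 [leRHS]mulrAC ler_pdivlMr // -!mulrA ler_wpM2l // ler_wpM2l //.
  by rewrite -natrX -natrM ler_nat mulnC bin_ffact ffact_le_exp.
have fp0 : 0 <= 4 * p0 by rewrite mulr_ge0 // ltW.
have n1 : 1 <= n%:R :> R by rewrite ler1n.
have p0h : p0 <= 2^-1.
  by apply: first_moment_rate_half => //; apply: leq_trans cEn; apply: leq_addr.
clearbody p0.
(* The negated conclusion is kept as [hW]: a window wider than [p0 / d] is what leaves room for the
   added clauses. *)
rewrite leNgt; apply/negP => hW; move: (hW); apply/negP; rewrite -leNgt.
pose g : R := n%:R * (4^-1 ^+ M * (2^-1 * (2^-1 * 2^-1 ^+ m))).
have g0 : 0 < g by rewrite /g !(mulr_gt0, exprn_gt0, invr_gt0).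
have gk : 2 * k%:R <= g.
  have : (size_req k d)%:R <= n%:R :> R by rewrite ler_nat.
  rewrite /size_req !natrM !natrX -/m -/M => h.
  have -> : g = n%:R / (4 * 4 ^+ M * 2 ^+ m).
    by rewrite /g !exprVn; field; rewrite !expf_neq0 ?pnatr_eq0.
  rewrite ler_pdivlMr ?mulr_gt0 ?exprn_gt0 //; apply: le_trans h.
  by rewrite le_eqVlt; apply/orP; left; apply/eqP; ring.
pose b : R := 2 * (M%:R * k%:R ^+ M).
have M0 : (0 < M)%N by rewrite !muln_gt0 d0 (ltnW (ltnW k2)).
have k0' : 0 < k%:R :> R by rewrite ltr0n (ltnW (ltnW k2)).
have M0' : 0 < M%:R :> R by rewrite ltr0n.
have b0 : 0 < b by apply: mulr_gt0 => //; apply: mulr_gt0 => //; apply: exprn_gt0.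
(* For [j >= g >= 2 k] one has ['C(j, k) >= (g / 2) ^ k / k!], hence ['C(j, k) * p1 >= b], and
   [power_le_inv] gives the failure probability [b^-1] that [window_core] asks for. *)
pose p1 : R := b * k`!%:R * (2 / g) ^+ k.
have f0 : 0 < k`!%:R :> R by rewrite ltr0n fact_gt0.
have p10 : 0 < p1 by rewrite /p1 mulr_gt0 ?exprn_gt0 ?divr_gt0 // mulr_gt0.
pose J := (16 * 2 ^ (M + m)).+1.
have hM : M%:R * p1 * (J%:R + 1) <= P1 - P0.
  apply: le_trans (ltW hW).
  have nk0 : 0 < n%:R ^+ k :> R by rewrite exprn_gt0.
  pose G : R := 8 * 4 ^+ M * 2 ^+ m.
  have hg : 2 / g = G / n%:R.
    rewrite /g /G !exprVn; field.
    have nn0 := lt0r_neq0 n0'.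
    have pn0 (a : R) i : 0 < a -> a ^+ i != 0 by move=> /lt0r_neq0; apply: expf_neq0.
    by rewrite nn0 !pn0.
  pose A : R := M%:R ^+ 2 * k%:R ^+ M * G ^+ k * (18 * 2 ^+ (M + m)).
  have hA : A * d%:R <= n%:R.
    have : (amplify_req k d)%:R <= n%:R :> R by rewrite ler_nat.
    suff -> : (amplify_req k d)%:R = A * d%:R by [].
    by rewrite /amplify_req /A /G !(natrM, natrX).
  have hJ : J%:R + 1 <= 18 * 2 ^+ (M + m) :> R.
    have -> : J%:R = 16 * 2 ^+ (M + m) + 1 :> R by rewrite /J -[LHS]natr1 natrM natrX.
    have : 1 <= 2 ^+ (M + m) :> R by rewrite exprn_ege1 // ler1n.
    by clear; lra.
  apply: (@le_trans _ _ (p0 / d%:R)); last first.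
    rewrite ler_wpM2r ?invr_ge0 // -[leLHS]mul1r ler_wpM2r ?(ltW p00) //.
    by rewrite ler_pdivlMr // mul1r; move: eta2; clear; lra.
  rewrite ler_pdivlMr // /p1 hg expr_div_n -(ler_pM2r nk0).
  apply: le_trans p0lb.
  have -> : M%:R * (b * k`!%:R * (G ^+ k / n%:R ^+ k)) * (J%:R + 1) * d%:R * n%:R ^+ k =
     2 * k`!%:R * (M%:R ^+ 2 * k%:R ^+ M * G ^+ k * (J%:R + 1) * d%:R).
    by rewrite /b; field; rewrite lt0r_neq0.
  rewrite [leRHS]mulrAC ler_wpM2l ?mulr_ge0 //.
  apply: le_trans hA; rewrite ler_wpM2r ?(ltW d0') // ler_wpM2l //.
  by rewrite !mulr_ge0 ?exprn_ge0 ?mulr_ge0 ?exprn_ge0.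
have p11 : p1 <= 1.
  apply: (@le_trans _ _ (P1 - P0)); last by move: P1p0 p0h P00; clear; lra.
  apply: le_trans hM; rewrite -mulrA mulrCA -[leLHS]mulr1 ler_wpM2l ?(ltW p10) //.
  have : 1 <= M%:R :> R by rewrite ler1n.
  have : 0 <= J%:R :> R by [].
  move=> hJ hM1; rewrite -[leLHS]mulr1 ler_pM //; lra.
apply: (@window_core R n k d eta p0 P0 P1 p1) => //.
- exact: ltnW.
- move=> p pp00 pp; apply: (@le_trans _ _ ((8 * E%:R)^-1)).
    apply: (@blocking_small (20 * d) E%:R (2 ^+ (18 * d)) p p0) => //.
    + by apply: leq_trans Mn; rewrite leq_pmull.
    + move: Eeta eta2 eta0; case: (E) => [|e]; rewrite ?mul0r; [lra|by rewrite ler1n].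
    + by rewrite exprn_ege1 // ler1n.
    + have : (blocking_req k E d)%:R <= n%:R :> R by rewrite ler_nat.
      suff -> : (blocking_req k E d)%:R =
        (8 * E%:R * 2 ^+ (18 * d) * (20 * d)%:R ^+ 2 * (k%:R * (20 * d)%:R) ^+ k *
         (clause_cst k)%:R) ^+ 2 :> R by [].
      by rewrite /blocking_req !(natrM, natrX).
  have E0 : 0 < E%:R :> R.
    by move: Eeta; case: (E) => [|e _]; rewrite ?mul0r ?ltr0n //; lra.
  rewrite invfM mulrC ler_pM2r ?invr_gt0 // -div1r ler_pdivrMr //; by rewrite mulrC.
- by rewrite (ltW p10).
- move=> j gj; rewrite -/b; rewrite -/g in gj.
  rewrite -[leRHS]mul1r ler_pdivlMr //.
  have p1i : 0 <= p1 <= 1 by rewrite (ltW p10).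
  apply: le_trans (power_le_inv 'C(j, k) p1i).
  rewrite ler_wpM2l ?exprn_ge0 ?subr_ge0 //.
  have := @bin_ge_real R (g / 2) j k _ _ _.
  move=> /(_ (divr_ge0 (ltW g0) (ler0n _ _))) h.
  have {}h : (g / 2) ^+ k <= k`!%:R * 'C(j, k)%:R.
    by apply: h; [rewrite mulrC divfK ?pnatr_eq0|apply: le_trans gj].
  apply: (@le_trans _ _ ('C(j, k)%:R * p1)); last by rewrite lerDr.
  rewrite /p1; have -> : 'C(j, k)%:R * (b * k`!%:R * (2 / g) ^+ k) =
     b * ((k`!%:R * 'C(j, k)%:R) * (2 / g) ^+ k) by ring.
  rewrite -[leLHS]mulr1 ler_wpM2l ?(ltW b0) //.
  apply: le_trans (ler_wpM2r _ h); last by rewrite exprn_ge0 // divr_ge0 // ltW.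
  by rewrite -exprMn mulrA divfK ?pnatr_eq0 // divff ?expr1n // lt0r_neq0.
Qed.

End Bounds.

(** * The quantiles [p_nae] and the final bound *)

Section Threshold.
Variables (R : realType) (n k : nat).
Implicit Types (p alpha eta : R).

Lemma product_measure_cover p : product_measure p (nae_cover n k) = Ex p (@unsat R n k).
Proof.
rewrite /product_measure /Ex big_mkcond /=; apply: eq_bigr => F _.
by rewrite in_nae_cover /unsat; case: (_ == _); rewrite ?mulr1 ?mulr0.
Qed.

(** The expected number of solutions is at most [2^n * exp(-2n) <= exp(-n) <= 1 / n <= 1 / E <=
    eta]. *)
Lemma unsat_first_moment eta (E : nat) : 0 < eta -> 1 <= E%:R * eta -> (E <= n)%N ->
  (0 < 'C(n, k))%N -> 2 * n%:R / 'C(n, k)%:R <= 1 :> R ->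
  1 - eta <= Ex (2 * n%:R / 'C(n, k)%:R) (@unsat R n k).
Proof.
move=> eta0 Eeta En C0 p01.
have C0' : 0 < 'C(n, k)%:R :> R by rewrite ltr0n.
set p0 : R := 2 * n%:R / 'C(n, k)%:R in p01 *.
have p00 : 0 <= p0 by rewrite divr_ge0 // mulr_ge0.
apply: le_trans (sol_rate n k _); last by rewrite p00.
rewrite lerD2l lerN2.
have h1 : (1 - p0) ^+ 'C(n, k) <= expR (- (2 * n%:R)).
  have -> : expR (- (2 * n%:R)) = expR (- p0) ^+ 'C(n, k) :> R.
    rewrite -expRM_natr; congr expR; rewrite /p0; field; exact: lt0r_neq0.
  by apply: lerXn2r; rewrite ?nnegrE ?expR_ge0 ?subr_ge0 // expR_ge1Dx.
have h2 : 2 ^+ n <= expR n%:R :> R.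
  rewrite -[n%:R]mul1r expRM_natr; apply: lerXn2r; rewrite ?nnegrE ?expR_ge0 //.
  by apply: le_trans (expR_ge1Dx 1); lra.
apply: (@le_trans _ _ (expR n%:R * expR (- (2 * n%:R)))).
  by apply: ler_pM; rewrite ?exprn_ge0 ?subr_ge0.
rewrite -expRD (_ : n%:R + - (2 * n%:R) = - n%:R); last by ring.
rewrite expRN -div1r ler_pdivrMr ?expR_gt0 // mulrC.
apply: le_trans Eeta _; rewrite ler_wpM2r ?(ltW eta0) //.
apply: le_trans (_ : n%:R <= _); first by rewrite ler_nat.
by apply: le_trans (expR_ge1Dx n%:R); rewrite lerDr.
Qed.

End Threshold.

Local Open Scope classical_set_scope.

(** Monotonicity in [p] handles points strictly between the infima: some rate reaching [eta] lies
    below [p], while [p] itself cannot reach [1 - eta]. The rate [p0] makes both sets nonempty. *)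
Lemma p_nae_window (R : realType) (n k : nat) (eta p0 : R) :
  0 < eta -> eta < 1 / 2 -> 0 <= p0 <= 1 -> 1 - eta <= Ex p0 (@unsat R n k) ->
  [/\ 0 <= p_nae k n eta, p_nae k n (1 - eta) <= p0 &
   forall p, p_nae k n eta < p -> p < p_nae k n (1 - eta) ->
     eta <= Ex p (@unsat R n k) <= 1 - eta].
Proof.
move=> eta0 eta2 p001 hp0; have /andP[p00 p01] := p001.
rewrite /p_nae.
pose A alpha : set R := [set p : R | 0 <= p <= 1 /\ alpha <= product_measure p (nae_cover n k)].
have lbA alpha : lbound (A alpha) 0 by move=> p [/andP[]].
have Ap0 : A (1 - eta) p0 by split; rewrite ?product_measure_cover.
have Aeta : A eta p0.
  split=> //; rewrite product_measure_cover; apply: le_trans hp0; move: eta2; lra.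
have P1p0 : inf (A (1 - eta)) <= p0 by apply: ge_inf => //; exists 0; apply: lbA.
split => //; first by apply: lb_le_inf; [exists p0|apply: lbA].
move=> p P0p pP1.
have p1 : p <= 1 by apply: le_trans p01; apply: le_trans P1p0; apply: ltW.
have [q [/andP[q0 q1] qA] qp] := inf_lt (ex_intro _ p0 Aeta) P0p.
have p0' : 0 <= p by apply: le_trans q0 (ltW qp).
apply/andP; split.
  rewrite product_measure_cover in qA; apply: le_trans qA _.
  by apply: Ex_mono => //; [move=> F G; apply: unsat_mono|exact: ltW].
rewrite leNgt; apply/negP => hp; move: pP1; apply/negP; rewrite -leNgt.
apply: ge_inf; first by exists 0; apply: lbA.
by split; rewrite ?product_measure_cover ?p0' // ltW.
Qed.

Theorem theorem8p8 (R : realType) (k : nat) (eta : R) :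
  (3 <= k)%N -> 0 < eta -> eta < 1 / 2 ->
  exists C : R, \forall n \near \oo,
    window_nae eta k n <= C * (n%:R / ln (n%:R : R)).
Proof.
move=> k2 eta0 eta2.
pose E := (Num.truncn (1 / eta)).+1.
have Eeta : 1 <= E%:R * eta by rewrite -ler_pdivrMr // ltW // truncnS_gt.
have [Q Q1 HQ] := parameters_exist k E.
(* The number of clauses times [2 n / 'C(n, k)] is [2 ^ k * n]; the last factor comes from
   [ln n <= (d + 1) * ln Q <= 2 * d * ln Q]. *)
exists (2 ^+ k * (32 / eta) * (2 * ln Q%:R)).
near=> n.
have Qn : (Q <= n)%N by near: n; exact: nbhs_infty_ge.
have n0 : (0 < n)%N by apply: leq_trans Qn; apply: ltnW.
pose d := trunc_log Q n.
have Qd : (Q ^ d <= n)%N := trunc_logP Q1 n0.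
have nQ : (n < Q ^ d.+1)%N := trunc_log_ltn n Q1.
have d0 : (0 < d)%N.
  rewrite lt0n; apply: contraL nQ => /eqP ->; by rewrite expn1 -leqNgt.
have [Mn szn ampn blkn cEn] := HQ d n d0 Qd.
have kn : (2 * k <= n)%N.
  by apply: leq_trans Mn; rewrite leq_mul2l /= leq_pmulr // muln_gt0.
have C0 : (0 < 'C(n, k))%N by rewrite bin_gt0; apply: leq_trans kn; rewrite leq_pmull.
have cn : (clause_cst k <= n)%N by apply: leq_trans cEn; apply: leq_addr.
have En : (E <= n)%N by apply: leq_trans cEn; apply: leq_addl.
have p0h := @first_moment_rate_half R n k k2 n0 kn cn.
set p0 : R := 2 * n%:R / 'C(n, k)%:R in p0h.
have p00 : 0 <= p0 by rewrite divr_ge0 // mulr_ge0.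
have p01 : p0 <= 1 by apply: le_trans p0h _; lra.
have p001 : 0 <= p0 <= 1 by rewrite p00.
have hp0 := unsat_first_moment eta0 Eeta En C0 p01.
have [P00 P1p0 crit] := p_nae_window eta0 eta2 p001 hp0.
have W := window_bound k2 d0 eta0 eta2 Eeta Mn szn ampn blkn cEn P00 P1p0 crit.
have C0' : 0 < 'C(n, k)%:R :> R by rewrite ltr0n.
have d0' : 0 < d%:R :> R by rewrite ltr0n.
have n0' : 0 < n%:R :> R by rewrite ltr0n.
have n1 : 1 < n%:R :> R by rewrite ltr1n; apply: leq_trans Qn.
have ln0 : 0 < ln n%:R :> R by rewrite ln_gt0.
have Q0' : 0 < Q%:R :> R by rewrite ltr0n ltnW.
have lnd : ln n%:R <= 2 * ln Q%:R * d%:R :> R.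
  apply: (@le_trans _ _ (ln (Q%:R ^+ d.+1))).
    by rewrite ler_ln ?posrE ?exprn_gt0 // -natrX ler_nat ltnW.
  rewrite lnXn // -[leLHS]mulr_natr.
  have lnQ : 0 < ln Q%:R :> R by rewrite ln_gt0 // ltr1n.
  have -> : 2 * ln Q%:R * d%:R = ln Q%:R * (2 * d)%:R :> R by rewrite natrM; ring.
  rewrite ler_wpM2l ?(ltW lnQ) // ler_nat; move: d0; clear; lia.
rewrite /window_nae card_nae_clause; last exact: ltnW (ltnW k2).
apply: le_trans (ler_wpM2l (ler0n _ _) W) _.
have k1 : (0 < k)%N by apply: ltnW (ltnW k2).
have -> : (2 ^ k.-1 * 'C(n, k))%:R * (32 / eta * (2 * n%:R / 'C(n, k)%:R) / d%:R) =
   2 ^+ k * (32 / eta) * (n%:R / d%:R) :> R.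
  rewrite natrM natrX -[in RHS](prednK k1) exprS; field.
  by rewrite !lt0r_neq0.
rewrite -[leRHS]mulrA ler_wpM2l ?mulr_ge0 ?exprn_ge0 ?invr_ge0 ?(ltW eta0) //.
rewrite mulrCA ler_wpM2l ?(ltW n0') // ler_pdivlMr //.
by rewrite mulrC ler_pdivrMr.
Unshelve. all: by end_near.
Qed.
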